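(* Let $n\ge 1$ and let $f:\mathbf{M}^n\to\mathbb{Z}$ be submodular, given by a value oracle. It is possible to decide whether the zero vector $\mathbf{0}\in\mathbb{R}^{[n]\times A}$ is contained in $P_M(f)$ in time polynomial in $n$ and $\max_{\mathbf{t}\in\mathbf{M}^n}|f(\mathbf{t})|$.
   Context: Let $\mathbf{M}$ be a diamond: elements a bottom $0_M$, a top $1_M$, and a finite set $A$ of atoms with $|A|\ge3$, where $0_M<a<1_M$ for all $a\in A$ and distinct atoms are incomparable. $\mathbf{M}^n$ is the product lattice with coordinatewise order, meet and join. A function $f:\mathbf{M}^n\to\mathbb{R}$ is submodular if $f(\mathbf{s}\wedge\mathbf{t})+f(\mathbf{s}\vee\mathbf{t})\le f(\mathbf{s})+f(\mathbf{t})$ for all $\mathbf{s},\mathbf{t}$. For $\mathbf{x}\in\mathbb{R}^{[n]\times A}$ and $\mathbf{y}\in\mathbf{M}^n$ define $\mathbf{x}(\mathbf{y})=\sum_{i=1}^n g_i$, where $g_i=0$ if $\mathbf{y}(i)=0_M$, $g_i=\mathbf{x}(i,\mathbf{y}(i))$ if $\mathbf{y}(i)\in A$, and $g_i=\max_{a\ne a'\in A}(\mathbf{x}(i,a)+\mathbf{x}(i,a'))$ if $\mathbf{y}(i)=1_M$. Let $P_M(f)=\{\mathbf{x}\in\mathbb{R}^{[n]\times A}\mid \mathbf{x}(\mathbf{y})\le f(\mathbf{y})\ \forall \mathbf{y}\in\mathbf{M}^n\}$. *)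

(* Defs.v *)
From HB Require Import structures.
From mathcomp Require Import all_boot all_order all_algebra.
From mathcomp Require Import boolp classical_sets reals.

Set Implicit Arguments.
Unset Strict Implicit.
Unset Printing Implicit Defensive.

Import Order.TTheory GRing.Theory Num.Theory.

Local Open Scope ring_scope.

Inductive diamond (A : Type) := DBot | DAtom of A | DTop.
Arguments DBot {A}.
Arguments DTop {A}.

Definition option2_of_diamond A (x : diamond A) : option (option A) :=
  match x with
  | DBot => None
  | DAtom a => Some (Some a)
  | DTop => Some None
  end.

Definition diamond_of_option2 A (x : option (option A)) : diamond A :=
  match x with
  | None => DBot
  | Some (Some a) => DAtom a
  | Some None => DTop
  end.

Lemma option2_of_diamondK A :
  cancel (@option2_of_diamond A) (@diamond_of_option2 A).
Proof. by case. Qed.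

HB.instance Definition _ (A : finType) :=
  Finite.copy (diamond A) (can_type (@option2_of_diamondK A)).

Section DiamondLattice.
Variable A : finType.
Implicit Types x y z : diamond A.

Definition diamond_le x y : bool :=
  match x, y with
  | DBot, _ | _, DTop => true
  | DAtom a, DAtom b => a == b
  | _, _ => false
  end.

Definition diamond_meet x y : diamond A :=
  match x, y with
  | DTop, z | z, DTop => z
  | DAtom a, DAtom b => if a == b then DAtom a else DBot
  | _, _ => DBot
  end.

Definition diamond_join x y : diamond A :=
  match x, y with
  | DBot, z | z, DBot => z
  | DAtom a, DAtom b => if a == b then DAtom a else DTop
  | _, _ => DTop
  end.

Lemma diamond_le_refl : reflexive diamond_le.
Proof. by case=> //= a; rewrite eqxx. Qed.

Lemma diamond_le_anti : antisymmetric diamond_le.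
Proof. by move=> [|a|] [|b|] //= /andP[/eqP->]. Qed.

Lemma diamond_le_trans : transitive diamond_le.
Proof. by move=> [|b|] [|a|] [|c|] //= /eqP->. Qed.

Fact diamond_display : Order.disp_t. Proof. exact: Order.Disp tt tt. Qed.

HB.instance Definition _ := Order.Le_isPOrder.Build diamond_display (diamond A)
  diamond_le_refl diamond_le_anti diamond_le_trans.

Lemma diamond_meetP x y z :
  (x <= diamond_meet y z)%O = (x <= y)%O && (x <= z)%O.
Proof.
change (diamond_le x (diamond_meet y z) = diamond_le x y && diamond_le x z).
case: x y z => [|a|] [|b|] [|c|] //=; rewrite ?andbT ?andbF //;
  case: (b =P c) => [bc|bc] //=; first by rewrite -bc andbb.
by case: (a =P b) => [->|//]; case: (b =P c).
Qed.

Lemma diamond_joinP x y z :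
  (diamond_join x y <= z)%O = (x <= z)%O && (y <= z)%O.
Proof.
change (diamond_le (diamond_join x y) z = diamond_le x z && diamond_le y z).
case: x y z => [|a|] [|b|] [|c|] //=; rewrite ?andbT ?andbF //;
  case: (a =P b) => [ab|ab] //=; first by rewrite -ab andbb.
by case: (a =P c) => [<-|//]; case: (b =P a) => // /esym.
Qed.

HB.instance Definition _ := Order.POrder_MeetJoin_isLattice.Build
  diamond_display (diamond A) diamond_meetP diamond_joinP.

End DiamondLattice.

(* Order, meet and join are those of the library's product order on tuples,
   which are coordinatewise. *)
Notation diamond_prod A n := (n.-tupleprod (diamond A)).

Definition submodular (V : numDomainType) (A : finType) (n : nat)
    (f : diamond_prod A n -> V) : Prop :=
  forall s t : diamond_prod A n,
    f (Order.meet s t) + f (Order.join s t) <= f s + f t.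

Section Polyhedron.
Variables (R : realType) (A : finType) (n : nat).

(* The default [head 0 s] makes this the maximum of every nonempty s, including
   those whose elements are all negative. *)
Definition seqmax (s : seq R) : R := \big[Num.max/head 0 s]_(v <- s) v.

Definition pair_max (x : {ffun 'I_n * A -> R}) (i : 'I_n) : R :=
  seqmax [seq x (i, p.1) + x (i, p.2) | p <- enum {: A * A} & p.1 != p.2].

Definition vec_val (x : {ffun 'I_n * A -> R}) (y : diamond_prod A n) : R :=
  \sum_(i < n) match tnth y i with
               | DBot => 0
               | DAtom a => x (i, a)
               | DTop => pair_max x i
               end.

Definition PM (f : diamond_prod A n -> R) : set {ffun 'I_n * A -> R} :=
  [set x | forall y : diamond_prod A n, vec_val x y <= f y]%classic.

End Polyhedron.

(* Model of computation: a random access machine with a value oracle, programmed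
   in a structured language, under the logarithmic cost criterion (every integer
   handled is charged its binary length). The memory consists of arrays, named
   by the naturals occurring in the program, of unbounded integers with
   arbitrary integer indices. *)

Definition store := nat -> int -> int.

Definition upd (s : store) (a : nat) (i v : int) : store :=
  fun b j => if (b == a) && (j == i) then v else s b j.

Inductive binop := OAdd | OSub | OMul | ODiv | OMod.

Inductive expr :=
  | ECst of int
  | EGet of nat & expr              (* a[e] *)
  | EBin of binop & expr & expr.

Inductive cmd :=
  | CSkip
  | CSet of nat & expr & expr       (* a[e1] := e2 *)
  | CSeq of cmd & cmd
  | CIf of expr & cmd & cmd         (* an expression tests true iff positive *)
  | CWhile of expr & cmd
  | CQuery of nat & nat.            (* r[0] := oracle (q[0], q[1], .. ) *)

Definition binop_val (o : binop) (x y : int) : int :=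
  match o with
  | OAdd => x + y
  | OSub => x - y
  | OMul => x * y
  | ODiv => (x %/ y)%Z
  | OMod => (x %% y)%Z
  end.

(* Number of binary digits of the absolute value. *)
Definition bits (z : int) : nat := up_log 2 (absz z).+1.

Fixpoint eval (s : store) (e : expr) : int :=
  match e with
  | ECst z => z
  | EGet a e1 => s a (eval s e1)
  | EBin o e1 e2 => binop_val o (eval s e1) (eval s e2)
  end.

Fixpoint ecost (s : store) (e : expr) : nat :=
  ((bits (eval s e)).+1 +
   match e with
   | ECst _ => 0
   | EGet _ e1 => ecost s e1
   | EBin _ e1 e2 => ecost s e1 + ecost s e2
   end)%N.

Definition query_word (k : nat) (s : store) (q : nat) : k.-tuple int :=
  [tuple s q (i%:Z) | i < k].

Section Exec.
Variables (k : nat) (oracle : k.-tuple int -> int).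

(* [exec c s t s']: started in memory s, the command c halts after time t in
   memory s'. *)
Inductive exec : cmd -> store -> nat -> store -> Prop :=
  | ExSkip s : exec CSkip s 1%N s
  | ExSet a e1 e2 s :
      exec (CSet a e1 e2) s (1 + ecost s e1 + ecost s e2)%N
           (upd s a (eval s e1) (eval s e2))
  | ExSeq c1 c2 s s1 s2 t1 t2 :
      exec c1 s t1 s1 -> exec c2 s1 t2 s2 ->
      exec (CSeq c1 c2) s (t1 + t2)%N s2
  | ExIf e c1 c2 s s1 t :
      exec (if 0 < eval s e then c1 else c2) s t s1 ->
      exec (CIf e c1 c2) s (1 + ecost s e + t)%N s1
  | ExWhileDone e c s :
      ~~ (0 < eval s e) -> exec (CWhile e c) s (1 + ecost s e)%N s
  | ExWhileStep e c s s1 s2 t1 t2 :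
      0 < eval s e -> exec c s t1 s1 -> exec (CWhile e c) s1 t2 s2 ->
      exec (CWhile e c) s (1 + ecost s e + t1 + t2)%N s2
  | ExQuery q r s :
      exec (CQuery q r) s
           (1 + \sum_(z <- query_word k s q) (bits z).+1
              + (bits (oracle (query_word k s q))).+1)%N
           (upd s r 0 (oracle (query_word k s q))).

Lemma exec_det c s t s' : exec c s t s' ->
  forall t2 s2, exec c s t2 s2 -> t = t2 /\ s' = s2.
Proof.
elim=> {c s t s'}.
- by move=> s t2 s2 H; inversion H.
- by move=> a e1 e2 s t2 s2 H; inversion H.
- move=> c1 c2 s s1 s2 t1 t2 _ IH1 _ IH2 t' s' H; inversion H; subst.
  by have [? ?] := IH1 _ _ ltac:(eassumption); subst;
     have [-> ->] := IH2 _ _ ltac:(eassumption).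
- move=> e c1 c2 s s1 t _ IH t' s' H; inversion H; subst.
  by have [-> ->] := IH _ _ ltac:(eassumption).
- move=> e c s ne t' s' H; inversion H; subst => //.
  by case/negP: ne.
- move=> e c s s1 s2 t1 t2 pe _ IH1 _ IH2 t' s' H; inversion H; subst.
    by exfalso; apply/negP: pe.
  by have [? ?] := IH1 _ _ ltac:(eassumption); subst;
     have [-> ->] := IH2 _ _ ltac:(eassumption).
- by move=> q r s t' s' H; inversion H.
Qed.

End Exec.

(* On input n the memory holds n in cell 0 of array 0 and is zero elsewhere. *)
Definition init_store (n : nat) : store :=
  upd (fun _ _ => 0) 0%N 0 n%:Z.

(* Halting verdict, read in cell 0 of array 0. *)
Definition accepting (s : store) : bool := s 0%N 0 != 0.

(* Codes of the elements of the diamond: 0 for the bottom, 1 for the top and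
   j + 2 for the j-th atom; every other integer is read as the bottom. *)
Definition decode (A : finType) (z : int) : diamond A :=
  match z with
  | Posz 1 => DTop
  | Posz j.+2 => nth DBot [seq DAtom a | a <- enum A] j
  | _ => DBot
  end.

Definition value_oracle (A : finType) (n : nat) (f : diamond_prod A n -> int)
  : n.-tuple int -> int :=
  fun w => f [tuple decode A (tnth w i) | i < n].

Definition max_abs (A : finType) (n : nat) (f : diamond_prod A n -> int) : nat :=
  (\max_(t : diamond_prod A n) absz (f t))%N.

(* Main.v *)
Require Import Defs.
From HB Require Import structures.
From mathcomp Require Import all_boot all_order all_algebra.
From mathcomp Require Import boolp classical_sets reals.
From mathcomp Require Import zify ring.

Set Implicit Arguments.
Unset Strict Implicit.
Unset Printing Implicit Defensive.

Import Order.TTheory GRing.Theory Num.Theory.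
Local Open Scope ring_scope.

(** The zero vector lies in P_M(f) iff f >= 0, so the task is to decide whether a
submodular f takes a negative value.

Glue the pages {(al, be) : N >= al >= be >= 0}, one for each atom, along the
diagonal al = be; the pages of two atoms a and b form the square with corners
0, a, b, 1.  Read at all thresholds, a point of the n-fold product of these
"books" is a chain in M^n, and f extends to a geodesically convex function on the
product.  The program runs subgradient descent on this extension.  Along the
chain each coordinate records the increments of f; a coordinate close to the
diagonal is raised from 0 to 1 in one step after all atoms have been queried, and
submodularity leaves at most one page on which f can decrease.  Away from the
diagonal and on it alike, moving each coordinate along its increments brings the
current point closer to every lattice point z with f z < 0, as long as all queried
values are nonnegative: with steps bounded by U and N = 24 n U^2, the squared
distance to z drops by at least 3N per round.  It starts below 3N * nN, so nN
rounds without a negative query prove f >= 0.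

The scale U is found from the values of f at the elements supported on a single
coordinate, which bound f from above by submodularity. *)

(** * A structured language over the machine *)

(* Memory layout: aN holds n, aQ the query word, aR the answer and aFL is raised by
   the first negative answer. *)
Notation aN := 0%N (only parsing).
Notation aQ := 1%N (only parsing).
Notation aR := 2%N (only parsing).
Notation aFL := 3%N (only parsing).

Inductive prog :=
  | PSkip
  | PSet of nat & expr & expr
  | PSeq of prog & prog
  | PIf of expr & prog & prog
  | PFor of nat & nat & prog
  | PQry.

Definition cell (a : nat) : expr := EGet a (ECst 0).
Definition eadd (e1 e2 : expr) : expr := EBin OAdd e1 e2.
Definition esub (e1 e2 : expr) : expr := EBin OSub e1 e2.

Fixpoint compile (p : prog) : cmd :=
  match p with
  | PSkip => CSkip
  | PSet a e1 e2 => CSet a e1 e2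
  | PSeq p1 p2 => CSeq (compile p1) (compile p2)
  | PIf e p1 p2 => CIf e (compile p1) (compile p2)
  | PFor v b q =>
      CSeq (CSet v (ECst 0) (ECst 0))
        (CWhile (esub (cell b) (cell v))
          (CSeq (compile q) (CSet v (ECst 0) (eadd (cell v) (ECst 1)))))
  | PQry => CSeq (CQuery aQ aR)
      (CIf (esub (ECst 0) (cell aR)) (CSet aFL (ECst 0) (ECst 1)) CSkip)
  end.

Fixpoint writes (p : prog) : seq nat :=
  match p with
  | PSkip => [::]
  | PSet a _ _ => [:: a]
  | PSeq p1 p2 | PIf _ p1 p2 => writes p1 ++ writes p2
  | PFor v _ q => v :: writes q
  | PQry => [:: aR; aFL]
  end.

(** A loop body may write neither its counter nor its bound, so the number of iterations is fixed on
    entry. Only [PQry] may touch the flag. *)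
Fixpoint wf (p : prog) : bool :=
  match p with
  | PSet a _ _ => a != aFL
  | PSeq p1 p2 | PIf _ p1 p2 => wf p1 && wf p2
  | PFor v b q =>
      [&& wf q, v \notin writes q, b \notin writes q, v != b & v != aFL]
  | _ => true
  end.

(** As an iteration count: a negative loop bound gives no iteration, in agreement with the compiled
    test. *)
Definition nat_of_int (z : int) : nat := if z is Posz m then m else 0%N.

(** * Denotational semantics and weakest preconditions *)

Section Semantics.
Variables (n : nat) (orc : n.-tuple int -> int).

Definition answer (s : store) : int := orc (query_word n s aQ).

Fixpoint den (p : prog) (s : store) : store :=
  match p with
  | PSkip => s
  | PSet a e1 e2 => upd s a (eval s e1) (eval s e2)
  | PSeq p1 p2 => den p2 (den p1 s)
  | PIf e p1 p2 => if 0 < eval s e then den p1 s else den p2 s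
  | PFor v b q =>
      iter (nat_of_int (s b 0))
        (fun s1 => upd (den q s1) v 0 (den q s1 v 0 + 1)) (upd s v 0 0)
  | PQry => let s1 := upd s aR 0 (answer s) in
            if answer s < 0 then upd s1 aFL 0 1 else s1
  end.

Lemma upd_other s a i v b j : b != a -> upd s a i v b j = s b j.
Proof. by rewrite /upd => /negPf->. Qed.

Lemma den_frame p s a i : a \notin writes p -> den p s a i = s a i.
Proof.
elim: p s => //=.
- by move=> b e1 e2 s; rewrite inE => /upd_other->.
- by move=> p1 IH1 p2 IH2 s; rewrite mem_cat negb_or => /andP[? ?]; rewrite IH2 ?IH1.
- move=> e p1 IH1 p2 IH2 s; rewrite mem_cat negb_or => /andP[? ?].
  by case: ifP => _; rewrite ?IH1 ?IH2.
- move=> v b q IH s; rewrite inE negb_or => /andP[av aq].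
  by elim: (nat_of_int _) => [|m IHm] /=; rewrite upd_other ?IH.
- move=> s; rewrite !inE negb_or => /andP[aR aFL].
  by case: ifP => _; rewrite !upd_other.
Qed.

(* With [strict] set, the postcondition only has to hold for runs in which no
   query returned a negative value. *)
Fixpoint wp (strict : bool) (p : prog) (Q : store -> Prop) (s : store) : Prop :=
  match p with
  | PSkip => Q s
  | PSet a e1 e2 => Q (upd s a (eval s e1) (eval s e2))
  | PSeq p1 p2 => wp strict p1 (wp strict p2 Q) s
  | PIf e p1 p2 => (0 < eval s e -> wp strict p1 Q s) /\
                   (eval s e <= 0 -> wp strict p2 Q s)
  | PFor v b q => exists Inv : nat -> store -> Prop,
      [/\ Inv 0%N (upd s v 0 0),
          forall j s1, (j < nat_of_int (s b 0))%N -> s1 v 0 = j%:Z ->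
            (forall a i, a \notin v :: writes q -> s1 a i = s a i) ->
            Inv j s1 -> wp strict q (fun s2 => Inv j.+1 (upd s2 v 0 j.+1%:Z)) s1
        & forall s1, (forall a i, a \notin v :: writes q -> s1 a i = s a i) ->
            Inv (nat_of_int (s b 0)) s1 -> Q s1]
  | PQry => if strict then 0 <= answer s -> Q (upd s aR 0 (answer s))
            else Q (den PQry s)
  end.

Lemma wp_mono st p (Q Q' : store -> Prop) s :
  (forall s1, Q s1 -> Q' s1) -> wp st p Q s -> wp st p Q' s.
Proof.
elim: p Q Q' s => //=.
- by move=> Q Q' s; apply.
- by move=> a e1 e2 Q Q' s; apply.
- by move=> p1 IH1 p2 IH2 Q Q' s QQ; apply: IH1 => s1; apply: IH2.
- by move=> e p1 IH1 p2 IH2 Q Q' s QQ [W1 W2]; split=> He;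
    [apply: IH1 (W1 He)|apply: IH2 (W2 He)].
- move=> v b q IH Q Q' s QQ [Inv [I0 I1 I2]]; exists Inv; split=> // s1 F1 J1.
  exact/QQ/I2.
- by case: st => Q Q' s QQ W; [move=> /W/QQ|apply: QQ].
Qed.

(** Arrays that a program does not write may be assumed unchanged when its postcondition is proved,
    so specifications need only mention what changes. *)
Lemma wp_frame st p (Q : store -> Prop) s :
  wp st p (fun s1 => (forall a i, a \notin writes p -> s1 a i = s a i) -> Q s1) s ->
  wp st p Q s.
Proof.
elim: p Q s => //=.
- by move=> Q s; apply.
- by move=> a e1 e2 Q s; apply=> b i; rewrite inE => /upd_other->.
- move=> p1 IH1 p2 IH2 Q s W; apply: IH1; apply: wp_mono W => s1 W F1.
  apply: IH2; apply: wp_mono W => s2 W F2; apply: W => a i.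
  by rewrite mem_cat negb_or => /andP[? ?]; rewrite F2 ?F1.
- move=> e p1 IH1 p2 IH2 Q s [W1 W2].
  split=> He; [apply: IH1; move: (W1 He)|apply: IH2; move: (W2 He)];
    apply: wp_mono => s1 W F; apply: W => a i;
    by rewrite mem_cat negb_or => /andP[? ?]; apply: F.
- move=> v b q IH Q s [Inv [I0 I1 I2]]; exists Inv; split=> // s1 F1 J1.
  exact: I2.
- case: st => Q s W; first move=> /W{}W; apply: W => a i; rewrite !inE negb_or.
    by case/andP=> aR _; rewrite upd_other.
  by case/andP=> aR aFL; case: ifP => _; rewrite !upd_other.
Qed.

Lemma wp_consequence st p (Q Q' : store -> Prop) s :
  wp st p Q s ->
  (forall s1, (forall a i, a \notin writes p -> s1 a i = s a i) -> Q s1 -> Q' s1) ->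
  wp st p Q' s.
Proof.
by move=> W QQ; apply: wp_frame; apply: wp_mono W => s1 Qs F; apply: QQ.
Qed.

Lemma wp_seq st p1 p2 Q s : wp st p1 (wp st p2 Q) s -> wp st (PSeq p1 p2) Q s.
Proof. by []. Qed.

Lemma wp_set st a e1 e2 (Q : store -> Prop) s :
  (forall s1 : store, (forall b j, s1 b j =
     if (b == a) && (j == eval s e1) then eval s e2 else s b j) -> Q s1) ->
  wp st (PSet a e1 e2) Q s.
Proof. by apply. Qed.

Lemma wp_query (Q : store -> Prop) s :
  (0 <= answer s -> forall s1 : store, (forall b j, s1 b j =
     if (b == aR) && (j == 0) then answer s else s b j) -> Q s1) ->
  wp true PQry Q s.
Proof. by move=> H /H; apply. Qed.

Lemma wp_query_any st (Q : store -> Prop) s :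
  (forall s1 : store, s1 aR 0 = answer s ->
     (forall a i, a \notin [:: aR; aFL] -> s1 a i = s a i) -> Q s1) ->
  wp st PQry Q s.
Proof.
move=> H; have Qd : Q (den PQry s).
  apply: H => [|a i na]; last by apply: (@den_frame PQry).
  by rewrite /=; case: ifP.
by case: st => //= h; move: Qd; rewrite /= ltNge h.
Qed.

Lemma wp_for st v b q (Q : store -> Prop) s m (Inv : nat -> store -> Prop) :
  nat_of_int (s b 0) = m -> Inv 0%N (upd s v 0 0) ->
  (forall j (s1 : store), (j < m)%N -> s1 v 0 = j%:Z ->
     (forall a i, a \notin v :: writes q -> s1 a i = s a i) ->
     Inv j s1 -> wp st q (fun s2 => Inv j.+1 (upd s2 v 0 j.+1%:Z)) s1) ->
  (forall s1 : store, (forall a i, a \notin v :: writes q -> s1 a i = s a i) ->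
     Inv m s1 -> Q s1) ->
  wp st (PFor v b q) Q s.
Proof. by move=> <- I0 I1 I2; exists Inv; split. Qed.

(** The flag is never lowered. This carries the hypothesis of [wp_sound] back from a run to its
    initial segments. *)
Lemma flag_mono p s : wf p -> den p s aFL 0 = 0 -> s aFL 0 = 0.
Proof.
elim: p s => //=.
- by move=> a e1 e2 s na; rewrite upd_other // eq_sym.
- by move=> p1 IH1 p2 IH2 s /andP[w1 w2] d; apply: IH1 => //; apply: IH2.
- by move=> e p1 IH1 p2 IH2 s /andP[w1 w2]; case: ifP => _; [apply: IH1|apply: IH2].
- move=> v b q IH s /and5P[wq _ _ _ nv].
  elim: (nat_of_int _) => [|m IHm] /=; rewrite upd_other 1?eq_sym // => d.
  by apply: IHm; apply: IH.
- by move=> s _; case: ifP => _; rewrite /upd.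
Qed.

Lemma flag_cases p s : wf p ->
  den p s aFL 0 = s aFL 0 \/ den p s aFL 0 = 1.
Proof.
elim: p s => //=.
- by left.
- by move=> a e1 e2 s na; left; rewrite upd_other // eq_sym.
- move=> p1 IH1 p2 IH2 s /andP[w1 w2].
  by have [->|] := IH2 (den p1 s) w2; [exact: IH1|right].
- by move=> e p1 IH1 p2 IH2 s /andP[w1 w2]; case: ifP => _; [apply: IH1|apply: IH2].
- move=> v b q IH s /and5P[wq _ _ _ nv].
  elim: (nat_of_int _) => [|m IHm] /=; first by left; rewrite upd_other // eq_sym.
  rewrite upd_other 1?eq_sym //; set s1 := iter m _ _ in IHm *.
  by have [->|] := IH s1 wq; [|right].
- by move=> s _; case: ifP => _; [right|left; rewrite upd_other].
Qed.

Lemma flag_nonneg p s : wf p -> (forall w, 0 <= orc w) ->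
  den p s aFL 0 = s aFL 0.
Proof.
move=> + o0; elim: p s => //=.
- by move=> a e1 e2 s na; rewrite upd_other // eq_sym.
- by move=> p1 IH1 p2 IH2 s /andP[w1 w2]; rewrite IH2 ?IH1.
- by move=> e p1 IH1 p2 IH2 s /andP[w1 w2]; case: ifP => _; rewrite ?IH1 ?IH2.
- move=> v b q IH s /and5P[wq _ _ _ nv].
  by elim: (nat_of_int _) => [|m IHm] /=; rewrite upd_other 1?eq_sym ?IH.
- by move=> s _; rewrite ltNge o0 /= upd_other.
Qed.

(** In strict mode a final flag of 0 certifies that no query answered negatively, so the assumption
    that [wp] makes at each query is met. *)
Lemma wp_sound st p (Q : store -> Prop) s : wf p -> wp st p Q s ->
  (st -> den p s aFL 0 = 0) -> Q (den p s).
Proof.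
elim: p Q s => //=.
- move=> p1 IH1 p2 IH2 Q s /andP[w1 w2] W fl.
  apply: IH2 => //; apply: (IH1 _ _ _ W) => // /fl.
  exact: flag_mono.
- move=> e p1 IH1 p2 IH2 Q s /andP[w1 w2] [W1 W2].
  by case: ltP => [/W1|/W2]; [apply: IH1|apply: IH2].
- move=> v b q IH Q s /and5P[wq vq bq vb nv] [Inv [I0 I1 I2]] fl.
  set g := fun s1 => upd (den q s1) v 0 (den q s1 v 0 + 1).
  have fr m a i : a \notin v :: writes q -> iter m g (upd s v 0 0) a i = s a i.
    rewrite inE negb_or => /andP[av aq].
    by elim: m => [|m IHm]; rewrite ?iterS /= ?/g upd_other ?den_frame.
  have gv m : iter m g (upd s v 0 0) v 0 = m%:Z.
    elim: m => [|m IHm]; first by rewrite /= /upd !eqxx.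
    by rewrite iterS {1}/g /upd !eqxx /= den_frame // IHm; lia.
  apply: I2; first exact: fr.
  move: fl; rewrite -/g.
  (* Induction over the prefixes of the loop; [flag_mono] passes the lowered flag from each prefix
     to the shorter one. *)
  suff: forall m, (m <= nat_of_int (s b 0))%N ->
      (st -> iter m g (upd s v 0 0) aFL 0 = 0) -> Inv m (iter m g (upd s v 0 0)).
    by apply.
  elim=> // m IHm lm; rewrite iterS => fl.
  have fl' : st -> den q (iter m g (upd s v 0 0)) aFL 0 = 0.
    by move/fl; rewrite {1}/g upd_other // eq_sym.
  have -> : g (iter m g (upd s v 0 0)) =
            upd (den q (iter m g (upd s v 0 0))) v 0 m.+1%:Z.
    by rewrite {1}/g den_frame // gv; congr upd; lia.
  apply: (IH (fun s2 => Inv m.+1 (upd s2 v 0 m.+1%:Z))) => //.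
  apply: I1 => //; first exact: fr.
  by apply: IHm; [exact: ltnW|move/fl'; exact: flag_mono].
- case: st => Q s _ W fl; last exact: W.
  move: (fl isT); case: ltP => // /W //.
Qed.

End Semantics.
(** * Logarithmic cost *)

Lemma bits_le z b : (absz z < 2 ^ b)%N -> (bits z <= b)%N.
Proof. by move=> zb; apply: up_log_min. Qed.

Lemma bits_le_absz z : (bits z <= absz z)%N.
Proof. exact/bits_le/ltn_expl. Qed.

(** Products are excluded: they may double the bit length, which inside a loop would ruin a
    polynomial bound. Those needed, in [constants], are costed separately. *)
Fixpoint linear_expr (e : expr) : bool :=
  match e with
  | ECst _ => true
  | EGet _ e1 => linear_expr e1
  | EBin (OAdd | OSub) e1 e2 => linear_expr e1 && linear_expr e2
  | _ => false
  end.

(* Bounds both the number of nodes of a linear expression and the excess of the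
   bit length of its value over that of the memory cells it reads. *)
Fixpoint weight (e : expr) : nat :=
  match e with
  | ECst z => (absz z).+1
  | EGet _ e1 => (weight e1).+1
  | EBin _ e1 e2 => (weight e1 + weight e2).+1
  end.

Definition magnitude (s : store) (b : nat) :=
  forall a i, (absz (s a i) < 2 ^ b)%N.

Lemma magnitude_le s b b' : (b <= b')%N -> magnitude s b -> magnitude s b'.
Proof. by move=> bb m a i; apply: leq_trans (m a i) _; rewrite leq_exp2l. Qed.

Lemma eval_magnitude s b e : magnitude s b -> linear_expr e ->
  (absz (eval s e) < 2 ^ (b + weight e))%N.
Proof.
move=> ms; elim: e => [z|a e IH|o e1 IH1 e2 IH2] /=.
- move=> _; apply: leq_trans (ltn_expl (absz z) (isT : 1 < 2)%N) _.
  by rewrite leq_exp2l // addnS ltnW // ltnS leq_addl.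
- by move=> _; apply: leq_trans (ms _ _) _; rewrite leq_exp2l // leq_addr.
- have key : linear_expr e1 -> linear_expr e2 -> 
    (absz (eval s e1) + absz (eval s e2) < 2 ^ (b + (weight e1 + weight e2).+1))%N.
    move=> /IH1 h1 /IH2 h2; rewrite addnS expnS mul2n -addnn.
    apply: (leq_ltn_trans _ (_ : (absz (eval s e1) + 2 ^ (b + weight e2) < _)%N)).
      by rewrite leq_add2l ltnW.
    rewrite -addSn; apply: leq_add; apply: (leq_trans _ (leq_pexp2l _ _)).
    + exact: h1.
    + by [].
    + by rewrite addnA leq_addr.
    + exact: leqnn.
    + by [].
    + by rewrite leq_add2l leq_addl.
  by case: o => //= /andP[l1 l2]; apply: leq_ltn_trans (key l1 l2); lia.
Qed.

(** There are at most [weight e] nodes, and each is charged at most one more than the bit length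
    [b + weight e]. *)
Lemma ecost_magnitude s b e : magnitude s b -> linear_expr e ->
  (ecost s e <= weight e * (b + weight e).+1)%N.
Proof.
move=> ms; elim: e => [z|a e IH|o e1 IH1 e2 IH2] le.
- move: (bits_le (eval_magnitude ms le)) => /=; rewrite addn0 => h.
  by rewrite -[X in (X <= _)%N]mul1n; apply: leq_mul.
- move: (bits_le (eval_magnitude ms le)) (IH le) => /= h1 h2.
  rewrite mulSn; apply: leq_add => //; apply: leq_trans h2 _.
  by rewrite leq_mul2l; apply/orP; right; lia.
- have [le1 le2] : linear_expr e1 /\ linear_expr e2.
    by move: le => /=; case: o => // /andP.
  move: (bits_le (eval_magnitude ms le)) (IH1 le1) (IH2 le2) => /= h h1 h2.
  rewrite mulSn mulnDl; apply: leq_add => //; apply: leq_add.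
    by apply: leq_trans h1 _; rewrite leq_mul2l; apply/orP; right; lia.
  by apply: leq_trans h2 _; rewrite leq_mul2l; apply/orP; right; lia.
Qed.

(** * Cost of compiled programs *)

Section Cost.
Variables (n : nat) (orc : n.-tuple int -> int) (F kappa : nat).
Hypothesis orcF : forall w, (absz (orc w) <= F)%N.

(** The first factor covers two expressions of weight at most [kappa] in an assignment, or the [n]
    cells of a query word and the answer. *)
Definition step_cost (b : nat) : nat := (1 + (kappa + kappa + n + 1) * (b + kappa).+2)%N.

Lemma step_cost_mono b b' : (b <= b')%N -> (step_cost b <= step_cost b')%N.
Proof. by move=> bb; rewrite leq_add2l leq_mul2l; apply/orP; right; lia. Qed.

Lemma leq_step_cost M M' b b' : (M <= M')%N -> (b <= b')%N ->
  (M * step_cost b <= M' * step_cost b')%N.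
Proof. by move=> MM /step_cost_mono bb; apply: leq_mul. Qed.

(* A run of M elementary steps: each step lengthens the numbers in memory by at
   most kappa bits, so the cost is quadratic in M. *)
Definition runs (c : cmd) (s s' : store) (M : nat) := forall b, (F <= b)%N ->
  magnitude s b -> magnitude s' (b + kappa * M) /\
  exists2 t, exec orc c s t s' & (t <= M * step_cost (b + kappa * M))%N.

Definition light (e : expr) := linear_expr e && (weight e <= kappa)%N.

Lemma light_cost s b e : light e -> magnitude s b ->
  (ecost s e <= kappa * (b + kappa).+1)%N.
Proof.
case/andP=> le we ms; apply: leq_trans (ecost_magnitude ms le) _.
by apply: leq_mul => //; rewrite ltnS leq_add2l.
Qed.

Lemma runs_skip s : runs CSkip s s 1.
Proof.
move=> b Fb ms; split; first by apply: magnitude_le ms; rewrite leq_addr.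
by exists 1%N; [exact: ExSkip|rewrite mul1n /step_cost].
Qed.

Lemma runs_set a e1 e2 s : light e1 -> light e2 ->
  runs (CSet a e1 e2) s (upd s a (eval s e1) (eval s e2)) 1.
Proof.
move=> l1 l2 b Fb ms; rewrite muln1; split.
  move=> c i; rewrite /upd; case: ifP => _.
    case/andP: l2 => le we; apply: leq_trans (eval_magnitude ms le) _.
    by rewrite leq_exp2l // leq_add2l.
  by apply: leq_trans (ms _ _) _; rewrite leq_exp2l // leq_addr.
eexists; first exact: ExSet.
move: (light_cost l1 ms) (light_cost l2 ms); rewrite mul1n /step_cost => h1 h2.
rewrite -addnA leq_add2l; apply: leq_trans (leq_add h1 h2) _.
by rewrite -mulnDl; apply: leq_mul; lia.
Qed.

Lemma runs_query q r s :
  runs (CQuery q r) s (upd s r 0 (orc (query_word n s q))) 1.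
Proof.
move=> b Fb ms; rewrite muln1.
(* An answer of absolute value at most [F] is below [2 ^ F], so it respects any bound with
   [b >= F]. *)
have oF : (absz (orc (query_word n s q)) < 2 ^ b)%N.
  apply: leq_ltn_trans (orcF _) _; apply: leq_ltn_trans Fb _; exact: ltn_expl.
split.
  move=> c i; rewrite /upd; case: ifP => _.
    by apply: leq_trans oF _; rewrite leq_exp2l // leq_addr.
  by apply: leq_trans (ms _ _) _; rewrite leq_exp2l // leq_addr.
eexists; first exact: ExQuery.
have hs : (\sum_(z <- query_word n s q) (bits z).+1 <= n * b.+1)%N.
  rewrite big_tuple; apply: leq_trans (_ : \sum_(i < n) b.+1 <= _)%N; last first.
    by rewrite sum_nat_const card_ord.
  by apply: leq_sum => i _; rewrite tnth_mktuple ltnS; apply: bits_le.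
rewrite mul1n /step_cost -addnA leq_add2l.
apply: leq_trans (leq_add hs (bits_le oF : _ < b.+1)%N) _.
by rewrite -[X in (_ + X)%N]mul1n -mulnDl; apply: leq_mul; lia.
Qed.

Lemma runs_seq c1 c2 s s1 s2 M1 M2 : runs c1 s s1 M1 -> runs c2 s1 s2 M2 ->
  runs (CSeq c1 c2) s s2 (M1 + M2).
Proof.
move=> r1 r2 b Fb ms; have [m1 [t1 e1 h1]] := r1 b Fb ms.
have [|m2 [t2 e2 h2]] := r2 _ _ m1; first by lia.
have E : (b + kappa * M1 + kappa * M2 = b + kappa * (M1 + M2))%N.
  by rewrite mulnDr addnA.
rewrite E in m2 h2; split=> //; exists (t1 + t2)%N; first exact: ExSeq e1 e2.
rewrite mulnDl; apply: leq_add h2; apply: leq_trans h1 _.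
by apply: leq_step_cost => //; rewrite mulnDr; lia.
Qed.

Lemma runs_le c s s' M M' : (M <= M')%N -> runs c s s' M -> runs c s s' M'.
Proof.
move=> MM r b Fb ms; have [m [t e h]] := r b Fb ms.
have bb : (b + kappa * M <= b + kappa * M')%N by rewrite leq_add2l leq_mul2l MM orbT.
split; first exact: magnitude_le m.
by exists t => //; apply: leq_trans h _; apply: leq_step_cost.
Qed.

Lemma test_cost s b e M : light e -> magnitude s b ->
  (1 + ecost s e <= step_cost (b + M))%N.
Proof.
move=> le ms; rewrite /step_cost leq_add2l; apply: leq_trans (light_cost le ms) _.
by apply: leq_mul; lia.
Qed.

Lemma runs_if e c1 c2 s s' M : light e ->
  runs (if 0 < eval s e then c1 else c2) s s' M -> runs (CIf e c1 c2) s s' (M + 1).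
Proof.
move=> le r b Fb ms; have [m [t x h]] := r b Fb ms; rewrite mulnDr.
split; first by apply: magnitude_le m; lia.
eexists; first exact: ExIf x.
rewrite mulnDl mul1n addnC; apply: leq_add; last exact: test_cost.
by apply: leq_trans h _; apply: leq_step_cost; lia.
Qed.

Lemma runs_while_done e c s : light e -> eval s e <= 0 -> runs (CWhile e c) s s 1.
Proof.
move=> le e0 b Fb ms; split; first by apply: magnitude_le ms; lia.
eexists; first by apply: ExWhileDone; rewrite -leNgt.
by rewrite mul1n test_cost.
Qed.

Lemma runs_while_step e c s s1 s2 M1 M2 : light e -> 0 < eval s e ->
  runs c s s1 M1 -> runs (CWhile e c) s1 s2 M2 ->
  runs (CWhile e c) s s2 (M1 + 1 + M2).
Proof.
move=> le e0 r1 r2 b Fb ms; have [m1 [t1 e1 h1]] := r1 b Fb ms.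
have [|m2 [t2 e2 h2]] := r2 _ _ m1; first by lia.
split; first by apply: magnitude_le m2; rewrite !mulnDr; lia.
eexists; first exact: (ExWhileStep e0 e1 e2).
set x := (b + kappa * (M1 + 1 + M2))%N.
have {}h1 : (t1 <= M1 * step_cost x)%N.
  by apply: leq_trans h1 _; apply: leq_step_cost; rewrite // /x !mulnDr; lia.
have {}h2 : (t2 <= M2 * step_cost x)%N.
  by apply: leq_trans h2 _; apply: leq_step_cost; rewrite // /x !mulnDr; lia.
have h : (1 + ecost s e <= step_cost x)%N by exact: test_cost.
by move: (step_cost x) h h1 h2 => y; rewrite !mulnDl mul1n; lia.
Qed.

Fixpoint light_prog (p : prog) : bool :=
  match p with
  | PSet _ e1 e2 => light e1 && light e2
  | PSeq p1 p2 => light_prog p1 && light_prog p2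
  | PIf e p1 p2 => [&& light e, light_prog p1 & light_prog p2]
  | PFor _ _ q => light_prog q
  | _ => true
  end.

Fixpoint loop_bounds (p : prog) : seq nat :=
  match p with
  | PSeq p1 p2 | PIf _ p1 p2 => loop_bounds p1 ++ loop_bounds p2
  | PFor _ b q => b :: loop_bounds q
  | _ => [::]
  end.

(** [env] bounds the loop limits. Both branches of a test are added, so that the count does not
    depend on memory. A loop pays once for its initialisation and its last test, and in every
    iteration for a test and an increment. *)
Fixpoint steps (p : prog) (env : nat -> nat) : nat :=
  match p with
  | PSeq p1 p2 => (steps p1 env + steps p2 env)%N
  | PIf _ p1 p2 => (steps p1 env + steps p2 env + 1)%N
  | PFor _ b q => (2 + env b * (steps q env + 2))%N
  | PQry => 3%N
  | _ => 1%N
  end.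

(** No loop limit is ever written, so the limits found at the start stay valid and [steps] can be
    evaluated in advance. *)
Lemma runs_compile p s env : (6 <= kappa)%N -> wf p -> light_prog p ->
  {in loop_bounds p, forall b, b \notin writes p} ->
  {in loop_bounds p, forall b, (nat_of_int (s b 0%R) <= env b)%N} ->
  runs (compile p) s (den orc p s) (steps p env).
Proof.
move=> k6; elim: p s => //=.
- by move=> s *; exact: runs_skip.
- by move=> a e1 e2 s _ /andP[l1 l2] _ _; exact: runs_set.
- move=> p1 IH1 p2 IH2 s /andP[w1 w2] /andP[l1 l2] lw le.
  have lw1 : {in loop_bounds p1 ++ loop_bounds p2, 
      forall b, (b \notin writes p1) && (b \notin writes p2)}.
    by move=> b /lw; rewrite mem_cat negb_or.
  apply: runs_seq.
    apply: IH1 => // b bp; [have := lw1 b|have := le b]; rewrite mem_cat bp => /(_ isT) //.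
    by case/andP.
  apply: IH2 => // b bp; have := lw1 b; rewrite mem_cat bp orbT => /(_ isT) /andP[b1 b2] //.
  by rewrite den_frame // le // mem_cat bp orbT.
- move=> e p1 IH1 p2 IH2 s /andP[w1 w2] /and3P[el l1 l2] lw le.
  have lw1 : {in loop_bounds p1 ++ loop_bounds p2, 
      forall b, (b \notin writes p1) && (b \notin writes p2)}.
    by move=> b /lw; rewrite mem_cat negb_or.
  apply: runs_if => //; case: ifP => _.
    apply: (@runs_le _ _ _ (steps p1 env)); first by rewrite leq_addr.
    apply: IH1 => // b bp; [have := lw1 b|have := le b]; rewrite mem_cat bp => /(_ isT) //.
    by case/andP.
  apply: (@runs_le _ _ _ (steps p2 env)); first by rewrite leq_addl.
  apply: IH2 => // b bp; [have := lw1 b|have := le b]; rewrite mem_cat bp orbT => /(_ isT) //.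
  by case/andP.
- move=> v b q IH s /and5P[wq vq bq vb nv] lq lw le.
  set body := CSeq (compile q) _; set g := fun s1 => upd _ v 0 _.
  (* Induction on the number [m] of iterations still to come; a negative limit leaves [m = 0]. *)
  have key m : forall s1 : store,
      s1 v 0 = (nat_of_int (s b 0))%:Z - m%:Z -> ((0 < m)%N -> 0 <= s b 0) ->
      (forall a i, a \notin v :: writes q -> s1 a i = s a i) ->
      runs (CWhile (esub (cell b) (cell v)) body) s1 (iter m g s1) (m * (steps q env + 2) + 1).
    elim: m => [|m IHm] s1 sv m0 fr.
      apply: runs_while_done; first by rewrite /light /=; lia.
      rewrite /= sv fr ?inE ?negb_or 1?eq_sym ?vb //.
      by case: (s b 0) => k /=; lia.
    rewrite iterSr mulSn -addnA.
    have -> : (steps q env + 2 + (m * (steps q env + 2) + 1) =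
               (steps q env + 1) + 1 + (m * (steps q env + 2) + 1))%N by lia.
    apply: (@runs_while_step _ _ _ (g s1)).
    + by rewrite /light /=; lia.
    + rewrite /= sv fr ?inE ?negb_or 1?eq_sym ?vb //.
      by have := m0 isT; case: (s b 0) => k /=; lia.
    + apply: runs_seq.
        apply: IH => // c cq.
          by have := lw c; rewrite !inE cq orbT => /(_ isT); rewrite negb_or => /andP[].
        have := lw c; rewrite !inE cq orbT => /(_ isT) cw.
        by rewrite fr // le // inE cq orbT.
      by apply: runs_set; rewrite /light /=; lia.
    + apply: IHm.
      * by rewrite /g /upd !eqxx /= den_frame // sv; lia.
      * by move=> _; exact: m0.
      * move=> c i; rewrite inE negb_or => /andP[cv cq].
        by rewrite /g upd_other // den_frame // fr // inE negb_or cv.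
  apply: (@runs_le _ _ _ (1 + (nat_of_int (s b 0) * (steps q env + 2) + 1))%N).
    rewrite addnCA addnC leq_add2l leq_mul2r; apply/orP; right.
    by apply: le; rewrite inE eqxx.
  apply: runs_seq; first by apply: runs_set; rewrite /light /=; lia.
  apply: key.
  - by rewrite /upd !eqxx /= subrr.
  - by case: (s b 0).
  - by move=> a i; rewrite inE negb_or => /andP[av _] /=; rewrite upd_other.
- move=> s _ _ _ _; apply: (@runs_seq _ _ _ _ _ 1 2); first exact: runs_query.
  apply: (@runs_if _ _ _ _ _ 1); first by rewrite /light /=; lia.
  rewrite /= {1 2}/upd !eqxx /= sub0r oppr_gt0 -/(answer orc s).
  by case: ifP => _; [apply: runs_set; rewrite /light /=; lia|exact: runs_skip].
Qed.

End Cost.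
(** * The book of a diamond *)

Section Book.
Variable A : finType.
Implicit Types (z : diamond A) (P : int).

Definition page P : bool := (2 <= P) && (P < #|A|%:Z + 2).

Lemma page_nat (j : nat) : (j < #|A|)%N -> page j.+2%:Z.
Proof. by rewrite /page; move: #|A| => k; lia. Qed.

Lemma page_decode P : page P -> exists a : A, decode A P = DAtom a.
Proof.
case: P => [[|[|j]]|j] //; rewrite /page => /andP[_ jk].
have {}jk : (j < size (enum A))%N.
  have -> : size (enum A) = #|A| by rewrite cardE.
  lia.
rewrite /decode; case E : (enum A) => [|a0 r]; first by rewrite E in jk.
by rewrite (nth_map a0) -?E //; eexists.
Qed.

Lemma decode_inj P P' : page P -> page P' -> decode A P = decode A P' -> P = P'.
Proof.
case: P => [[|[|j]]|j] //; case: P' => [[|[|j']]|j'] //; rewrite /page.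
move=> /andP[_ jk] /andP[_ jk'] /eqP.
have E : size (enum A) = #|A| by rewrite cardE.
have s1 : (j < size [seq DAtom a | a <- enum A])%N by rewrite size_map E; lia.
have s2 : (j' < size [seq DAtom a | a <- enum A])%N by rewrite size_map E; lia.
rewrite /decode nth_uniq //; first by move/eqP->.
by rewrite map_inj_uniq ?enum_uniq // => a b [].
Qed.

Lemma decode_atom (a : A) : exists2 j : nat, (j < #|A|)%N & decode A j.+2%:Z = DAtom a.
Proof.
exists (index a (enum A)); first by rewrite cardE index_mem mem_enum.
by rewrite /= (nth_map a) ?nth_index ?index_mem ?mem_enum.
Qed.

Lemma eq_DAtom (a b : A) : (DAtom a == DAtom b) = (a == b).
Proof. by apply/eqP/eqP => [[]|->]. Qed.

(* Squared Euclidean distance between the point (al, be) of the half-square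
   N >= al >= be >= 0 attached to the atom P and the lattice element z. Any two
   of these half-squares are glued along the diagonal al = be into a square
   with corners 0, P, z and 1 of side N. *)
Definition sqdist (N P al be : int) z : int :=
  match z with
  | DBot => al * al + be * be
  | DTop => (al - N) * (al - N) + (be - N) * (be - N)
  | DAtom _ => if decode A P == z then (al - N) * (al - N) + be * be
               else al * al + (be - N) * (be - N)
  end.

Definition clip (N x : int) : int := if x < 0 then 0 else if N < x then N else x.

Lemma clip_le N x y : 0 <= N -> x <= y ->
  [/\ 0 <= clip N x, clip N x <= clip N y & clip N y <= N].
Proof. by rewrite /clip => *; split; do !case: ifP; lia. Qed.

Lemma clip0_sq N x : 0 <= N -> clip N x * clip N x <= x * x.
Proof. by move=> N0; rewrite /clip; case: ltP => [|x0]; [|case: ltP => ?]; nia. Qed.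

Lemma clipN_sq N x : 0 <= N -> (clip N x - N) * (clip N x - N) <= (x - N) * (x - N).
Proof. by move=> N0; rewrite /clip; case: ltP => [|x0]; [|case: ltP => ?]; nia. Qed.

(** Clipping is the projection onto an interval that contains [0] and [N], the only coordinates of
    corners. *)
Lemma sqdist_clip N P al be z : 0 <= N ->
  sqdist N P (clip N al) (clip N be) z <= sqdist N P al be z.
Proof.
move=> N0; case: z => [|a|] /=; try case: ifP => _; apply: lerD;
  by [exact: clip0_sq|exact: clipN_sq].
Qed.

(* The point is moved by -xa along the atom B and by -xb along the other atom of
   the square containing it and B, crossing the diagonal if necessary. *)
Definition move (N P al be B xa xb : int) : int * int * int :=
  let: (P1, al1, be1) :=
    if B == P then (P, al - xa, be - xb)
    else if be - xa < al - xb then (P, al - xb, be - xa)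
    else (B, be - xa, al - xb) in
  (P1, clip N al1, clip N be1).

(** Expanding the squares after a step [2 * x] gives [- 4 * g] to first order. The error
    [24 * (U * U)] allows [8 * (U * U)] for the quadratic terms and [16 * (U * U)] for treating a
    point within [4 * U] of the diagonal as if [al = be]. *)
Definition settles (N U P al be B xa xb : int) z (g : int) : Prop :=
  let: (P1, al1, be1) := move N P al be B xa xb in
  [/\ page P1, 0 <= be1, be1 <= al1, al1 <= N &
      sqdist N P1 al1 be1 z <= sqdist N P al be z - 4 * g + 24 * (U * U)].

Lemma sq_bound (x U : int) : `|x| <= U -> x * x <= U * U.
Proof. by move=> h; nia. Qed.

Lemma mul_bound (x y U V : int) : `|x| <= U -> `|y| <= V -> `|x * y| <= U * V.
Proof. by rewrite normrM => h1 h2; apply: ler_pM. Qed.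

(** Two steps of length at most [2 * U] cannot close a gap larger than [4 * U], so the point stays
    on its page. *)
Lemma settles_page N U P al be xa xb z : page P -> 0 <= be -> al <= N ->
  4 * U < al - be -> `|xa| <= U -> `|xb| <= U ->
  settles N U P al be P (2 * xa) (2 * xb) z
    (al * xa + be * xb - N * match z with
                             | DBot => 0
                             | DTop => xa + xb
                             | DAtom _ => if decode A P == z then xa else xb
                             end).
Proof.
move=> pP be0 alN far ha hb; rewrite /settles /move eqxx.
have N0 : 0 <= N by lia.
have [c1 c2 c3] := @clip_le N (be - 2 * xb) (al - 2 * xa) N0 ltac:(lia).
split=> //; apply: le_trans (sqdist_clip _ _ _ _ N0) _.
have := sq_bound ha; have := sq_bound hb.
by case: z => [|a|] /=; try case: ifP => _; lia.
Qed.

(* [e] is the smallest slope at the diagonal, attained on the page [B]. *)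
Lemma settles_spine N U P al be B e w ez z : page P -> page B -> 0 <= be ->
  be <= al -> al <= N -> al - be <= 4 * U ->
  `|e| <= U -> `|w| <= U -> `|w - e| <= U ->
  (z = DBot -> ez = 0) -> (z = DTop -> ez = w) ->
  (forall a, z = DAtom a -> e <= ez /\ (decode A B <> z -> w - e <= ez)) ->
  if 2 * e < w then settles N U P al be B (2 * e) (2 * (w - e)) z (be * w - N * ez)
  else settles N U P al be P w w z (be * w - N * ez).
Proof.
move=> pP pB be0 ba alN near he hw hwe z0 z1 za.
have N0 : 0 <= N by lia.
have d : `|al - be| <= 4 * U by lia.
have := sq_bound he; have := sq_bound hw; have := sq_bound hwe.
have := mul_bound he d; have := mul_bound hw d; have := mul_bound hwe d.
move=> m1 m2 m3 s1 s2 s3.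
(* If [w <= 2 * e], every atom has [ez >= e >= w / 2], so a step parallel to the diagonal serves all
   of them at once. *)
case: ifP => lt; last first.
  rewrite /settles /move eqxx.
  have [c1 c2 c3] := @clip_le N (be - w) (al - w) N0 ltac:(lia).
  split=> //; apply: le_trans (sqdist_clip _ _ _ _ N0) _.
  case: z z0 z1 za => [/(_ erefl)-> _ _|a _ _ /(_ a erefl)[e1 _]|_ /(_ erefl)-> _] /=.
  - by lia.
  - have ? : N * w <= N * (2 * ez) by apply: ler_wpM2l; lia.
    by case: ifP => _; lia.
  - by lia.
rewrite /settles /move; case: eqP => [BP|/eqP BP].
  rewrite BP in za *.
  have [c1 c2 c3] := @clip_le N (be - 2 * (w - e)) (al - 2 * e) N0 ltac:(lia).
  split=> //; apply: le_trans (sqdist_clip _ _ _ _ N0) _.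
  case: z z0 z1 za => [/(_ erefl)-> _ _|a _ _ /(_ a erefl)[e1 e2]|_ /(_ erefl)-> _] /=.
  - by lia.
  - case: eqP => [_|/e2 {}e2].
      have ? : N * e <= N * ez by apply: ler_wpM2l; lia.
    lia.
    have ? : N * (w - e) <= N * ez by apply: ler_wpM2l; lia.
    lia.
  - by lia.
(* Now [B] and [P] span a square in which [al] is the coordinate along [P] and [be] the one along
   [B], so the step [2 * e] acts on [be]. *)
have dBP : decode A B <> decode A P by move/(decode_inj pB pP)/eqP; rewrite (negPf BP).
case: ltP => lt2.
  have [c1 c2 c3] := @clip_le N (be - 2 * e) (al - 2 * (w - e)) N0 ltac:(lia).
  split=> //; apply: le_trans (sqdist_clip _ _ _ _ N0) _.
  case: z z0 z1 za => [/(_ erefl)-> _ _|a _ _ /(_ a erefl)[e1 e2]|_ /(_ erefl)-> _] /=.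
  - by lia.
  - case: eqP => [dP|dP].
      have {}e2 : w - e <= ez by apply: e2; rewrite -dP.
      have ? : N * (w - e) <= N * ez by apply: ler_wpM2l; lia.
    lia.
    have ? : N * e <= N * ez by apply: ler_wpM2l; lia.
    lia.
  - by lia.
have [c1 c2 c3] := @clip_le N (al - 2 * (w - e)) (be - 2 * e) N0 ltac:(lia).
split=> //; apply: le_trans (sqdist_clip _ _ _ _ N0) _.
case: z z0 z1 za => [/(_ erefl)-> _ _|a _ _ /(_ a erefl)[e1 e2]|_ /(_ erefl)-> _] /=.
- by lia.
- case: eqP => [dB|/e2 {}e2].
    rewrite -dB; case: eqP => [/esym//|_].
    have ? : N * e <= N * ez by apply: ler_wpM2l; lia.
    lia.
  have h : N * (w - e) <= N * ez by apply: ler_wpM2l; lia.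
  (* For a third atom [z] the crossing also exchanges the coordinates against which [z] is measured;
     as [be <= al], this can only lower the distance. *)
  by case: eqP => _; lia.
- by lia.
Qed.

End Book.
(** * Submodular functions on a power of the diamond *)

Section Submodular.
Variables (A : finType) (n : nat) (f : diamond_prod A n -> int).
Hypothesis sf : submodular f.
Implicit Types (y z : diamond_prod A n) (i : 'I_n).

Definition setc y i (v : diamond A) : diamond_prod A n :=
  [tuple if j == i then v else tnth y j | j < n].

Lemma tnth_setc y i v j : tnth (setc y i v) j = if j == i then v else tnth y j.
Proof. by rewrite tnth_mktuple. Qed.

Lemma setc_setc y i v w : setc (setc y i v) i w = setc y i w.
Proof. by apply: eq_from_tnth => j; rewrite !tnth_setc; case: (j == i). Qed.

Lemma setc_id y i : setc y i (tnth y i) = y.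
Proof. by apply: eq_from_tnth => j; rewrite tnth_setc; case: eqP => [->|]. Qed.

(** Submodularity for [z] met with [setc y i v], and [y]: their meet is [z] met with [y], and their
    join differs from [y] only at [i]. Summed along a chain this yields the subgradient
    inequality. *)
Lemma raise_coordinate z y i v : diamond_le (tnth y i) v ->
  f (setc y i (diamond_join (diamond_meet (tnth z i) v) (tnth y i))) - f y <=
  f (Order.meet z (setc y i v)) - f (Order.meet z y).
Proof.
move=> yv; have {yv}yv : (tnth y i <= v)%O := yv.
have := sf (Order.meet z (setc y i v)) y.
have -> : Order.meet (Order.meet z (setc y i v)) y = Order.meet z y.
  apply: eq_from_tnth => j; rewrite !tnth_meet tnth_setc -meetA.
  by case: eqP => [->|_]; [rewrite (meet_r yv)|rewrite meetxx].
have -> : Order.join (Order.meet z (setc y i v)) y =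
    setc y i (diamond_join (diamond_meet (tnth z i) v) (tnth y i)).
  apply: eq_from_tnth => j; rewrite tnth_join tnth_meet !tnth_setc.
  by case: eqP => [->//|_]; rewrite join_r // leIr.
by lia.
Qed.

(** Distinct atoms meet in the bottom and join in the top. Hence at most one atom has an increment
    below half that of the top. *)
Lemma two_atoms y i (a b : A) : tnth y i = DBot -> a != b ->
  f y + f (setc y i DTop) <= f (setc y i (DAtom a)) + f (setc y i (DAtom b)).
Proof.
move=> yi ab; apply: le_trans (sf _ _).
have -> : Order.meet (setc y i (DAtom a)) (setc y i (DAtom b)) = y.
  apply: eq_from_tnth => j; rewrite tnth_meet !tnth_setc.
  case: eqP => [->|_]; last exact: meetxx.
  by rewrite yi; change (diamond_meet (DAtom a) (DAtom b) = DBot); rewrite /= (negPf ab).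
have -> // : Order.join (setc y i (DAtom a)) (setc y i (DAtom b)) = setc y i DTop.
apply: eq_from_tnth => j; rewrite tnth_join !tnth_setc.
case: eqP => [_|_]; last exact: joinxx.
by change (diamond_join (DAtom a) (DAtom b) = DTop); rewrite /= (negPf ab).
Qed.

Definition bottom : diamond_prod A n := [tuple DBot | _ < n].

Lemma meet_bottom y : Order.meet y bottom = bottom.
Proof.
apply: eq_from_tnth => j; rewrite tnth_meet tnth_mktuple.
by case: (tnth y j).
Qed.

Lemma meet_top y y1 : (forall i, tnth y1 i = DTop) -> Order.meet y y1 = y.
Proof.
move=> h; apply: eq_from_tnth => j; rewrite tnth_meet h.
by case: (tnth y j).
Qed.

(** The coordinates of [y] are switched on one at a time; each element supported on one new
    coordinate meets the previous part in the bottom. *)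
Lemma upper_bound y : 0 <= f bottom -> (forall i v, 0 <= f (setc bottom i v)) ->
  f y <= f bottom + \sum_i f (setc bottom i (tnth y i)).
Proof.
move=> f0 fs.
(* [y] truncated to its first [m] coordinates. *)
pose h m : diamond_prod A n := [tuple if (j < m)%N then tnth y j else DBot | j < n].
have hS (m : 'I_n) : f (h m.+1) <= f (h m) + f (setc bottom m (tnth y m)).
  have := sf (h m) (setc bottom m (tnth y m)).
  have -> : Order.meet (h m) (setc bottom m (tnth y m)) = bottom.
    apply: eq_from_tnth => j; rewrite tnth_meet tnth_setc !tnth_mktuple.
    case: (j =P m) => [->|_]; first by rewrite ltnn; case: (tnth y m).
    by case: ifP => _ //; case: (tnth y j).
  have -> : Order.join (h m) (setc bottom m (tnth y m)) = h m.+1.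
    apply: eq_from_tnth => j; rewrite tnth_join tnth_setc !tnth_mktuple ltnS.
    case: (j =P m) => [->|/eqP jm]; first by rewrite ltnn leqnn; case: (tnth y m).
    have -> : (j <= m)%N = (j < m)%N by rewrite leq_eqVlt -[_ == _]/(j == m) (negPf jm).
    by case: ifP => _ //; case: (tnth y j).
  by lia.
have key m : (m <= n)%N ->
    f (h m) <= f bottom + \sum_(i < n | (i < m)%N) f (setc bottom i (tnth y i)).
  elim: m => [|m IH] mn.
    have -> : h 0%N = bottom by apply: eq_from_tnth => j; rewrite !tnth_mktuple.
    by rewrite big_pred0 ?addr0.
  apply: le_trans (hS (Ordinal mn)) _.
  rewrite (bigD1 (Ordinal mn)) //= addrCA addrC; apply: lerD => //.
  apply: le_trans (IH (ltnW mn)) _; rewrite lerD2l le_eqVlt; apply/orP; left.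
  by apply/eqP; apply: eq_bigl => i; rewrite -val_eqE /=; lia.
have hn : h n = y by apply: eq_from_tnth => j; rewrite tnth_mktuple ltn_ord.
have := key n (leqnn n); rewrite hn => /le_trans; apply.
by rewrite lerD2l (eq_bigl xpredT) // => i; rewrite ltn_ord.
Qed.

Definition word (s : store) : diamond_prod A n := [tuple decode A (s aQ j%:Z) | j < n].

Lemma answerE s : answer (value_oracle f) s = f (word s).
Proof.
rewrite /answer /value_oracle; congr f.
by apply: eq_from_tnth => j; rewrite !tnth_mktuple.
Qed.

Lemma word_eq (s s1 : store) : (forall j, s1 aQ j = s aQ j) -> word s1 = word s.
Proof. by move=> E; apply: eq_from_tnth => j; rewrite !tnth_mktuple E. Qed.

Lemma word_set (s s1 : store) i v :
  (forall j, s1 aQ j = if j == i%:Z then v else s aQ j) ->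
  word s1 = setc (word s) i (decode A v).
Proof.
move=> E; apply: eq_from_tnth => j; rewrite tnth_setc !tnth_mktuple E.
by rewrite eqz_nat -[(_ == _ :> nat)]/(j == i); case: eqP.
Qed.

End Submodular.
(** * The program *)

(* Coordinate i of the current point lies on the page with code aPG[i], at position
   (aAL[i], aBE[i]); its pending step is aXA[i] along the atom aPB[i] and aXB[i]
   along the other ones. aCUR caches the value of f at the query word, aU holds U,
   aNN holds N, aN1 = N + 1, aK = 4U is the width of the zone treated as diagonal,
   aT the number of rounds, and aKA, aKB the numbers of atoms and of codes. *)
Notation aU := 4%N (only parsing).
Notation aNN := 5%N (only parsing).
Notation aK := 6%N (only parsing).
Notation aT := 7%N (only parsing).
Notation aKA := 8%N (only parsing).
Notation aKB := 9%N (only parsing).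
Notation aAL := 10%N (only parsing).
Notation aBE := 11%N (only parsing).
Notation aPG := 12%N (only parsing).
Notation aXA := 13%N (only parsing).
Notation aXB := 14%N (only parsing).
Notation aPB := 15%N (only parsing).
Notation aCUR := 16%N (only parsing).
Notation aI := 17%N (only parsing).
Notation aJ := 18%N (only parsing).
Notation aTH := 19%N (only parsing).
Notation aTAU := 20%N (only parsing).
Notation aW := 21%N (only parsing).
Notation aE := 22%N (only parsing).
Notation aBEST := 23%N (only parsing).
Notation aM := 24%N (only parsing).
Notation aN1 := 25%N (only parsing).

Declare Scope prog_scope.
Delimit Scope prog_scope with P.
Notation "p ;; q" := (PSeq p q) (at level 60, right associativity) : prog_scope.
Notation "a <- e" := (PSet a (ECst 0) e) (at level 55, e at level 50) : prog_scope.
Notation "a @i<- e" := (PSet a (cell aI) e) (at level 55, e at level 50) : prog_scope.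
Notation "a @i" := (EGet a (cell aI)) (at level 20) : prog_scope.

(** The machine only tests positivity, so equality takes two tests. *)
Definition pif_eq (e1 e2 : expr) (p q : prog) : prog :=
  PIf (esub e1 e2) q (PIf (esub e2 e1) q p).

Lemma wp_pif_eq n (orc : n.-tuple int -> int) st e1 e2 p q Q s :
  (eval s e1 = eval s e2 -> wp orc st p Q s) ->
  (eval s e1 <> eval s e2 -> wp orc st q Q s) ->
  wp orc st (pif_eq e1 e2 p q) Q s.
Proof.
by move=> Hp Hq; split=> /= h1; [|split=> /= h2];
  [apply: Hq|apply: Hq|apply: Hp]; lia.
Qed.

(** Loop counters run upwards, whereas the thresholds are scanned downwards from [N] to [0]. *)
Definition level : expr := esub (cell aNN) (cell aTH).

Definition raise_atom : prog := (
  aQ @i<- aPG @i ;; PQry ;; aPB @i<- aPG @i ;;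
  aXA @i<- esub (eadd (cell aR) (cell aR)) (eadd (cell aCUR) (cell aCUR)) ;;
  aCUR <- cell aR)%P.

Definition raise_top : prog := (
  aQ @i<- ECst 1 ;; PQry ;;
  aXB @i<- esub (eadd (cell aR) (cell aR)) (eadd (cell aCUR) (cell aCUR)) ;;
  aCUR <- cell aR)%P.

(** The first atom is queried beforehand, so that the minimum starts at an attained value. *)
Definition best_atom : prog := (
  aQ @i<- ECst 2 ;; PQry ;; aM <- cell aR ;; aBEST <- ECst 2 ;;
  PFor aJ aKA (
    aQ @i<- eadd (cell aJ) (ECst 2) ;; PQry ;;
    PIf (esub (cell aM) (cell aR))
      (aM <- cell aR ;; aBEST <- eadd (cell aJ) (ECst 2)) PSkip))%P.

(** If twice the least atom increment falls below the increment to the top, the step descends along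
    the best page. Otherwise the page is kept and equal steps give a move parallel to the
    diagonal. *)
Definition raise_spine : prog := (
  best_atom ;;
  aQ @i<- ECst 1 ;; PQry ;;
  aW <- esub (cell aR) (cell aCUR) ;; aE <- esub (cell aM) (cell aCUR) ;;
  aCUR <- cell aR ;;
  PIf (esub (cell aW) (eadd (cell aE) (cell aE)))
    (aPB @i<- cell aBEST ;; aXA @i<- eadd (cell aE) (cell aE) ;;
     aXB @i<- eadd (esub (cell aW) (cell aE)) (esub (cell aW) (cell aE)))
    (aPB @i<- aPG @i ;; aXA @i<- cell aW ;; aXB @i<- cell aW))%P.

(** Far from the diagonal a coordinate becomes an atom at threshold [al] and the top at threshold
    [be]. Near it, the coordinate jumps from bottom to top at [be]. *)
Definition event : prog :=
  PIf (esub (esub (aAL @i) (aBE @i)) (cell aK))%P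
    (pif_eq (aAL @i) level raise_atom (pif_eq (aBE @i) level raise_top PSkip))%P
    (pif_eq (aBE @i) level raise_spine PSkip)%P.

Definition clip_cell (a : nat) : prog :=
  (PIf (esub (ECst 0) (a @i)) (a @i<- ECst 0)
    (PIf (esub (a @i) (cell aNN)) (a @i<- cell aNN) PSkip))%P.

Definition update : prog := (
  pif_eq (aPB @i) (aPG @i)
    (aAL @i<- esub (aAL @i) (aXA @i) ;; aBE @i<- esub (aBE @i) (aXB @i))
    (aE <- esub (aBE @i) (aXA @i) ;; aW <- esub (aAL @i) (aXB @i) ;;
     PIf (esub (cell aW) (cell aE))
       (aAL @i<- cell aW ;; aBE @i<- cell aE)
       (aPG @i<- aPB @i ;; aAL @i<- cell aE ;; aBE @i<- cell aW)) ;;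
  clip_cell aAL ;; clip_cell aBE)%P.

Definition round : prog := (
  PFor aI aN (aQ @i<- ECst 0) ;; PQry ;; aCUR <- cell aR ;;
  PFor aTH aN1 (PFor aI aN event) ;;
  PFor aI aN update)%P.

Definition main_loop : prog := PFor aTAU aT round.

(** When all answers are nonnegative, their sum over every coordinate and code dominates the
    right-hand side of [upper_bound], which selects one code per coordinate. The summand 1 keeps [U]
    positive; code 2 puts every coordinate on the page of the first atom. *)
Definition survey : prog := (
  aU <- eadd (ECst 1) (cell aR) ;;
  PFor aI aN (
    PFor aJ aKB (aQ @i<- cell aJ ;; PQry ;; aU <- eadd (cell aU) (cell aR)) ;;
    aQ @i<- ECst 0 ;; aPG @i<- ECst 2))%P.

Definition setup (k : nat) : prog :=
  (aKA <- ECst k%:Z ;; aKB <- ECst k.+2%:Z ;; PQry)%P.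

Definition emul (e1 e2 : expr) : expr := EBin OMul e1 e2.

(** [N] equals the sum of the [n] error terms [24 * (U * U)] of one round. *)
Definition constants : prog := (
  aNN <- emul (ECst 24) (emul (cell aN) (emul (cell aU) (cell aU))) ;;
  aK <- emul (ECst 4) (cell aU) ;;
  aT <- emul (cell aN) (cell aNN) ;;
  aN1 <- eadd (cell aNN) (ECst 1))%P.

Definition verdict : prog := (aN <- esub (ECst 1) (cell aFL))%P.
(** * Subgradients along the chain *)

Section Round.
Variables (A : finType) (n : nat) (f : diamond_prod A n -> int).
Hypothesis sf : submodular f.
Variables (z : diamond_prod A n) (N U : int).
Hypothesis fU : forall y, f y <= U.

(* Coordinate j once all thresholds >= d have been scanned; g is the part of the
   first-order decrease of the squared distance to z contributed so far. *)
Definition coord_inv (s : store) (zj : diamond A) (d j g : int) : Prop :=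
  let al := s aAL j in let be := s aBE j in let P := s aPG j in
  let finished := s aQ j = 1 /\
        settles N U P al be (s aPB j) (s aXA j) (s aXB j) zj g in
  if d <= be then finished
  else if (4 * U < al - be) && (d <= al) then
    [/\ s aQ j = P, s aPB j = P & exists x, [/\ s aXA j = 2 * x, `|x| <= U &
        g = al * x - N * (if diamond_le (decode A P) zj then x else 0)]]
  else s aQ j = 0 /\ g = 0.

(* At th = 0 and m = n the inequality is the subgradient inequality for z: the word
   is then the top element, so that the gains add up to at least - N f(z). *)
Definition scanned (s : store) (th : int) (m : nat) : Prop :=
  [/\ s aCUR 0 = f (word A n s), 0 <= f (word A n s) &
   exists2 g : 'I_n -> int,
     forall j, coord_inv s (tnth z j) (if (j < m)%N then th else th + 1) j%:Z (g j) &
     th * f (word A n s) - N * f (Order.meet z (word A n s)) <= \sum_j g j].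

Definition state_ok (s : store) : Prop := forall j : 'I_n,
  [/\ page A (s aPG j%:Z), 0 <= s aBE j%:Z, s aBE j%:Z <= s aAL j%:Z & s aAL j%:Z <= N].

Lemma coord_inv_eq s s1 zj d j g :
  (forall a, a \in [:: aAL; aBE; aPG; aQ; aPB; aXA; aXB] -> s1 a j = s a j) ->
  coord_inv s zj d j g -> coord_inv s1 zj d j g.
Proof.
by move=> E; rewrite /coord_inv; do !rewrite [s1 _ _]E //.
Qed.

(** Raising coordinate [i] adds to its share of the gain a term that, by [raise_coordinate], is at
    least the growth of the left-hand side in [scanned]. *)
Lemma scan_advance s s1 th (i : 'I_n) v :
  scanned s th i ->
  (forall a j, a \in [:: aAL; aBE; aPG; aQ; aPB; aXA; aXB] -> j <> i%:Z ->
     s1 a j = s a j) ->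
  word A n s1 = setc (word A n s) i v -> diamond_le (tnth (word A n s) i) v ->
  s1 aCUR 0 = f (word A n s1) -> 0 <= f (word A n s1) -> 0 <= N ->
  (forall g, coord_inv s (tnth z i) (th + 1) i%:Z g ->
    coord_inv s1 (tnth z i) th i%:Z
      (g + (th * (f (word A n s1) - f (word A n s)) -
       N * (f (setc (word A n s) i
              (diamond_join (diamond_meet (tnth z i) v) (tnth (word A n s) i)))
            - f (word A n s))))) ->
  scanned s1 th i.+1.
Proof.
move=> [cur f0 [g gi gs]] fr ws yv cur1 f1 N0 ci; split=> //.
set dl := (_ - N * _) in ci.
exists (fun j => if j == i then g i + dl else g j).
  move=> j; case: (j =P i) => [->|/eqP ji].
    by rewrite ltnSn; apply: ci; have := gi i; rewrite ltnn.
  rewrite ltnS leq_eqVlt -[_ == _ :> nat]/(j == i) (negPf ji) /=.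
  apply: coord_inv_eq (gi j) => a aa; apply: fr => // -[/val_inj/eqP].
  by rewrite (negPf ji).
have -> : \sum_j (if j == i then g i + dl else g j) = \sum_j g j + dl.
  rewrite (bigD1 i) //= eqxx [in RHS](bigD1 i) //= addrAC; congr (_ + _ + _).
  by apply: eq_bigr => j /negPf->.
have h := raise_coordinate sf z yv; rewrite -ws in h.
move: gs h; rewrite /dl; move: (\sum_j g j) => S.
set a1 := f (setc _ _ _); set a2 := f (word A n s1); set a3 := f (word A n s).
set a4 := f (Order.meet z _); set a5 := f (Order.meet z (word A n s)) => gs h.
have := ler_wpM2l N0 h.
lia.
Qed.

(** * Specifications of the program fragments *)

Lemma raise_atom_spec (s : store) (i : 'I_n) : s aI 0 = i%:Z ->
  wp (value_oracle f) true raise_atom (fun s1 =>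
    [/\ word A n s1 = setc (word A n s) i (decode A (s aPG i%:Z)),
        0 <= f (word A n s1), s1 aCUR 0 = f (word A n s1),
        [/\ s1 aQ i%:Z = s aPG i%:Z, s1 aPB i%:Z = s aPG i%:Z &
            s1 aXA i%:Z = 2 * (f (word A n s1) - s aCUR 0)] &
        forall a j, a \in [:: aQ; aPB; aXA] -> j <> i%:Z -> s1 a j = s a j]) s.
Proof.
move=> sI; rewrite /raise_atom /= sI answerE => f0.
set s1 := upd s _ _ _ in f0 *.
have ws1 : word A n s1 = setc (word A n s) i (decode A (s aPG i%:Z)).
  by apply: word_set => j.
set s2 := upd _ aCUR _ _.
have ws2 : word A n s2 = word A n s1 by apply: word_eq.
rewrite ws2; split=> //.
  by rewrite /s2 /s1 /upd /= !eqxx sI !eqxx /=; split=> //; lia.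
move=> a j; rewrite !inE => /or3P[]/eqP-> /eqP/negPf ji;
  by rewrite /s2 /s1 /upd /= ?sI ?ji.
Qed.

Lemma raise_top_spec (s : store) (i : 'I_n) : s aI 0 = i%:Z ->
  wp (value_oracle f) true raise_top (fun s1 =>
    [/\ word A n s1 = setc (word A n s) i DTop,
        0 <= f (word A n s1), s1 aCUR 0 = f (word A n s1),
        s1 aQ i%:Z = 1 /\ s1 aXB i%:Z = 2 * (f (word A n s1) - s aCUR 0) &
        forall a j, a \in [:: aQ; aXB] -> j <> i%:Z -> s1 a j = s a j]) s.
Proof.
move=> sI; rewrite /raise_top /= sI answerE => f0.
set s1 := upd s _ _ _ in f0 *.
have ws1 : word A n s1 = setc (word A n s) i DTop.
  by apply: (@word_set _ _ _ _ _ 1) => j.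
set s2 := upd _ aCUR _ _.
have ws2 : word A n s2 = word A n s1 by apply: word_eq.
rewrite ws2; split=> //.
  by rewrite /s2 /s1 /upd /= !eqxx sI !eqxx /=; split=> //; lia.
move=> a j; rewrite !inE => /orP[]/eqP-> /eqP/negPf ji;
  by rewrite /s2 /s1 /upd /= ?sI ?ji.
Qed.

Lemma best_atom_spec (s : store) (i : 'I_n) : (0 < #|A|)%N ->
  s aI 0 = i%:Z -> s aKA 0 = #|A|%:Z ->
  wp (value_oracle f) true best_atom (fun s1 =>
    [/\ page A (s1 aBEST 0),
        s1 aM 0 = f (setc (word A n s) i (decode A (s1 aBEST 0))) /\ 0 <= s1 aM 0,
        exists v, word A n s1 = setc (word A n s) i v,
        (forall a : A, s1 aM 0 <= f (setc (word A n s) i (DAtom a)) ) &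
        forall j, j <> i%:Z -> s1 aQ j = s aQ j]) s.
Proof.
move=> A0 sI sA; rewrite /best_atom /= sI answerE => f0.
(* The tape entry at [i] stays unspecified, since [raise_spine] overwrites it after the loop. *)
exists (fun m s1 =>
    [/\ page A (s1 aBEST 0),
        s1 aM 0 = f (setc (word A n s) i (decode A (s1 aBEST 0))) /\ 0 <= s1 aM 0,
        exists v, word A n s1 = setc (word A n s) i v,
        (forall j, (j < m)%N -> s1 aM 0 <= f (setc (word A n s) i (decode A j.+2%:Z))) &
        forall j, j <> i%:Z -> s1 aQ j = s aQ j]).
have wset (s1 : store) v : word A n (upd s1 aQ i%:Z v) = setc (word A n s1) i (decode A v).
  by apply: word_set.
split.
- rewrite wset in f0; split=> //.
  + exact: (page_nat A0).
  + by rewrite /upd /= -/upd wset.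
  + by exists (decode A 2); rewrite -wset; apply: word_eq.
  + by move=> j ji; rewrite /upd /=; case: eqP ji.
- move=> j s1; rewrite /upd /= sA -/upd => jA sJ fr [pB [mB m0] [v wv] mn fQ].
  have s1I : s1 aI 0 = i%:Z by rewrite fr // /upd /=.
  have wj w : word A n (upd s1 aQ i%:Z w) = setc (word A n s) i (decode A w).
    by rewrite wset wv setc_setc.
  rewrite answerE s1I sJ wj (_ : j%:Z + 2 = j.+2%:Z); last by lia.
  move=> fj; split=> [lt|ge].
  - have key : forall j0, (j0 < j.+1)%N ->
        f (setc (word A n s) i (decode A j.+2%:Z)) <=
        f (setc (word A n s) i (decode A j0.+2%:Z)).
      move=> j0; rewrite ltnS leq_eqVlt => /orP[/eqP->//|/mn h].
      by apply: le_trans h; move: lt; rewrite /upd /=; lia.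
    split=> //; first exact: page_nat.
      by exists (decode A j.+2%:Z); rewrite -wj; apply: word_eq.
    by move=> j0 ji; rewrite /upd /= -[RHS]fQ //; case: eqP ji.
  - split=> //.
    + by exists (decode A j.+2%:Z); rewrite -wj; apply: word_eq.
    + move=> j0; rewrite ltnS leq_eqVlt => /orP[/eqP->//|/mn //].
      by move: ge; rewrite /upd /=; lia.
    + by move=> j0 ji; rewrite /upd /= -[RHS]fQ //; case: eqP ji.
- move=> s1; rewrite /upd /= sA /= => fr [pB mB wv mn fQ]; split=> // a.
  by have [j jA <-] := decode_atom a; apply: mn.
Qed.
#[local] Arguments wp : simpl never.

Lemma raise_spine_spec (s : store) (i : 'I_n) : (0 < #|A|)%N ->
  s aI 0 = i%:Z -> s aKA 0 = #|A|%:Z ->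
  wp (value_oracle f) true raise_spine (fun s1 =>
    [/\ word A n s1 = setc (word A n s) i DTop,
        0 <= f (word A n s1), s1 aCUR 0 = f (word A n s1),
        s1 aQ i%:Z = 1 /\ exists B,
          let e := f (setc (word A n s) i (decode A B)) - s aCUR 0 in
          let w := f (word A n s1) - s aCUR 0 in
          [/\ page A B, 0 <= f (setc (word A n s) i (decode A B)),
              forall a, e <= f (setc (word A n s) i (DAtom a)) - s aCUR 0 &
              if 2 * e < w then
                [/\ s1 aPB i%:Z = B, s1 aXA i%:Z = 2 * e & s1 aXB i%:Z = 2 * (w - e)]
              else [/\ s1 aPB i%:Z = s aPG i%:Z, s1 aXA i%:Z = w & s1 aXB i%:Z = w]] &
        forall a j, a \in [:: aQ; aPB; aXA; aXB] -> j <> i%:Z -> s1 a j = s a j]) s.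
Proof.
move=> A0 sI sA; apply: wp_seq.
apply: wp_consequence (best_atom_spec A0 sI sA) _ => s1 fr [pB [mB m0] [v wv] mn fQ].
have cur : s1 aCUR 0 = s aCUR 0 by rewrite fr.
have PG : s1 aPG i%:Z = s aPG i%:Z by rewrite fr.
have I1 : s1 aI 0 = i%:Z by rewrite fr.
have frw a j : a \in [:: aQ; aPB; aXA; aXB] -> j <> i%:Z -> s1 a j = s a j.
  by rewrite !inE => /or4P[]/eqP-> ji; rewrite ?fQ // fr.
move sB: (s1 aBEST 0) pB mB => B pB mB.
move sM: (s1 aM 0) mB m0 mn => m mB m0 mn {fr}.
apply: wp_seq; apply: wp_set => s2; rewrite /= I1 => E2.
apply: wp_seq; apply: wp_query; rewrite answerE => f0 s3 /= E3.
have ws2 : word A n s2 = setc (word A n s) i DTop.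
  have : word A n s2 = setc (word A n s1) i (decode A 1) by apply: word_set.
  by rewrite wv setc_setc.
apply: wp_seq; apply: wp_set => s4; rewrite /= !E3 !E2 /= cur => E4.
apply: wp_seq; apply: wp_set => s5; rewrite /= !E4 !E3 !E2 /= cur sM => E5.
apply: wp_seq; apply: wp_set => s6; rewrite /= !E5 !E4 !E3 /= => E6.
have W6 : s6 aW 0 = f (word A n s2) - s aCUR 0 by rewrite E6 E5 E4.
have e6 : s6 aE 0 = m - s aCUR 0 by rewrite E6 E5.
have I6 : s6 aI 0 = i%:Z by rewrite E6 E5 E4 E3 E2.
have B6 : s6 aBEST 0 = B by rewrite E6 E5 E4 E3 E2.
have P6 : s6 aPG i%:Z = s aPG i%:Z by rewrite E6 E5 E4 E3 E2.
have C6 : s6 aCUR 0 = f (word A n s2) by rewrite E6.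
have Q6 j : s6 aQ j = if j == i%:Z then 1 else s1 aQ j by rewrite E6 E5 E4 E3 E2.
have F6 a j : a \in [:: aPB; aXA; aXB] -> s6 a j = s1 a j.
  by rewrite !inE => /or3P[]/eqP->; rewrite E6 E5 E4 E3 E2.
clear E2 E3 E4 E5 E6.
rewrite -ws2; split; rewrite /= W6 e6 => cmp.
- apply: wp_seq; apply: wp_set => s7; rewrite /= I6 B6 => E7.
  apply: wp_seq; apply: wp_set => s8; rewrite /= !E7 /= I6 e6 => E8.
  apply: wp_set => s9; rewrite /= !E8 !E7 /= I6 e6 W6 => E9.
  have ws9 : word A n s9 = word A n s2.
    have : word A n s9 = setc (word A n s1) i (decode A 1).
      by apply: word_set => j; rewrite E9 E8 E7 Q6.
    by rewrite wv setc_setc ws2.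
  rewrite ws9; split=> //.
  + by rewrite E9 E8 E7 C6.
  + split; first by rewrite E9 E8 E7 Q6 eqxx.
    exists B; rewrite -mB; split=> //.
    * by move=> a; have := mn a; lia.
    * rewrite ifT; last by lia.
      by rewrite !E9 !E8 !E7 /= !eqxx /=; split=> //; lia.
  + move=> a j aa ji; rewrite -(frw a j) // E9 E8 E7; move/eqP/negPf: (ji) => ji'.
    by move: aa; rewrite ji' !andbF !inE => /or4P[]/eqP->; rewrite ?Q6 ?ji' ?F6.
- apply: wp_seq; apply: wp_set => s7; rewrite /= I6 P6 => E7.
  apply: wp_seq; apply: wp_set => s8; rewrite /= !E7 /= I6 W6 => E8.
  apply: wp_set => s9; rewrite /= !E8 !E7 /= I6 W6 => E9.
  have ws9 : word A n s9 = word A n s2.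
    have : word A n s9 = setc (word A n s1) i (decode A 1).
      by apply: word_set => j; rewrite E9 E8 E7 Q6.
    by rewrite wv setc_setc ws2.
  rewrite ws9; split=> //.
  + by rewrite E9 E8 E7 C6.
  + split; first by rewrite E9 E8 E7 Q6 eqxx.
    exists B; rewrite -mB; split=> //.
    * by move=> a; have := mn a; lia.
    * rewrite ifF; last by lia.
      by rewrite !E9 !E8 !E7 /= !eqxx /=; split=> //; lia.
  + move=> a j aa ji; rewrite -(frw a j) // E9 E8 E7; move/eqP/negPf: (ji) => ji'.
    by move: aa; rewrite ji' !andbF !inE => /or4P[]/eqP->; rewrite ?Q6 ?ji' ?F6.
Qed.

Lemma scan_skip s th (i : 'I_n) : scanned s th i ->
  (forall g, coord_inv s (tnth z i) (th + 1) i%:Z g -> coord_inv s (tnth z i) th i%:Z g) ->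
  scanned s th i.+1.
Proof.
case=> cur f0 [g gi gs] ci; split=> //; exists g => // j.
rewrite ltnS leq_eqVlt -[_ == _ :> nat]/(j == i).
by case: eqP => [->|_] /=; [apply: ci; have := gi i; rewrite ltnn|exact: gi].
Qed.

(** A coordinate changes only at the thresholds [al] and [be] when far from the diagonal, and only
    at [be] when near it; at any other threshold the invariants for [th + 1] and [th] agree. *)
Lemma event_spec (s : store) th (i : 'I_n) : (0 < #|A|)%N ->
  s aI 0 = i%:Z -> s aNN 0 = N -> s aK 0 = 4 * U -> s aKA 0 = #|A|%:Z ->
  N - s aTH 0 = th -> state_ok s -> scanned s th i ->
  wp (value_oracle f) true event (fun s1 => scanned s1 th i.+1) s.
Proof.
move=> A0 sI sN sK sA sth ok sc.
have [pP be0 ba aN] := ok i; have N0 : 0 <= N by lia.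
have [cur f0 _] := sc.
have U0 : 0 <= U by exact: le_trans f0 (fU _).
have yi : tnth (word A n s) i = decode A (s aQ i%:Z) by rewrite tnth_mktuple.
have [a Pa] := page_decode pP.
split; rewrite /= sI sK => far.
- apply: wp_pif_eq; rewrite /= ?sI sN sth => al.
  + apply: wp_consequence (raise_atom_spec sI) _ => s1 fr [ws f1 cur1 [q1 pb1 xa1] fro].
    have [AL BE PG] : [/\ s1 aAL i%:Z = s aAL i%:Z, s1 aBE i%:Z = s aBE i%:Z &
        s1 aPG i%:Z = s aPG i%:Z] by rewrite !fr.
    (* Here [th = al], so at [th + 1] the coordinate is still at the bottom and has contributed
       nothing. *)
    have start g : coord_inv s (tnth z i) (th + 1) i%:Z g -> s aQ i%:Z = 0 /\ g = 0.
      by rewrite /coord_inv; do 2![rewrite ifF; last by lia].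
    have y0 : tnth (word A n s) i = DBot.
      by have [_ _ [g gi _]] := sc; have := gi i; rewrite ltnn yi => /start[-> _].
    apply: (scan_advance sc (v := decode A (s aPG i%:Z))) => //.
    * move=> b j bb ji; move: bb; rewrite !inE.
      by move=> /orP[|/orP[|/orP[|/orP[|/orP[|/orP[]]]]]] /eqP->;
        first [exact: fr | exact: fro].
    * by rewrite y0.
    * move=> g /start[_ ->]; rewrite /coord_inv AL BE PG ifF; last by lia.
      rewrite ifT; last by lia.
      split=> //; exists (f (word A n s1) - f (word A n s)); split.
      - by rewrite xa1 cur.
      - by have := fU (word A n s1); have := fU (word A n s); lia.
      rewrite add0r ws y0 Pa al; congr (_ - N * _).
      have ybot : setc (word A n s) i DBot = word A n s by rewrite -y0 setc_id.
      case: (tnth z i) => [|b|] /=; rewrite ?ybot ?subrr //.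
      by rewrite eq_sym; case: eqP => [->|_]; rewrite ?ybot ?subrr.
  + apply: wp_pif_eq; rewrite /= ?sI sN sth => be.
    * apply: wp_consequence (raise_top_spec sI) _ => s1 fr [ws f1 cur1 [q1 xb1] fro].
      have [AL BE PG] : [/\ s1 aAL i%:Z = s aAL i%:Z, s1 aBE i%:Z = s aBE i%:Z &
        s1 aPG i%:Z = s aPG i%:Z] by rewrite !fr.
      have [PB XA] : s1 aPB i%:Z = s aPB i%:Z /\ s1 aXA i%:Z = s aXA i%:Z by rewrite !fr.
      have start g : coord_inv s (tnth z i) (th + 1) i%:Z g ->
          [/\ s aQ i%:Z = s aPG i%:Z, s aPB i%:Z = s aPG i%:Z &
          exists x, [/\ s aXA i%:Z = 2 * x, `|x| <= U & g = s aAL i%:Z * x -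
          N * (if diamond_le (decode A (s aPG i%:Z)) (tnth z i) then x else 0)]].
        by rewrite /coord_inv ifF ?ifT //; lia.
      have ya : tnth (word A n s) i = DAtom a.
        by have [_ _ [g gi _]] := sc; have := gi i; rewrite ltnn yi -Pa => /start[->].
      apply: (scan_advance sc (v := DTop)) => //.
      -- move=> b j bb ji; move: bb; rewrite !inE.
         by move=> /orP[|/orP[|/orP[|/orP[|/orP[|/orP[]]]]]] /eqP->;
           first [exact: fr | exact: fro].
      -- by rewrite ya.
      -- move=> g /start[_ pb [x [xa xU ->]]]; rewrite /coord_inv AL BE PG ifT; last by lia.
         split=> //; rewrite PB XA pb xa xb1 cur.
         (* Both queried values lie between [0] and [U], hence so does the absolute value of their
            difference. *)
         have xbU : `|f (word A n s1) - f (word A n s)| <= U.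
           by have := fU (word A n s1); have := fU (word A n s); lia.
         have := settles_page (tnth z i) pP be0 aN _ xU xbU.
         move=> /(_ ltac:(lia)); congr (settles _ _ _ _ _ _ _ _ _ _).
         have yat : setc (word A n s) i (DAtom a) = word A n s by rewrite -ya setc_id.
         rewrite ws ya Pa be; case: (tnth z i) => [|b|] /=; rewrite ?yat; try ring.
         rewrite eq_DAtom [b == a]eq_sym.
         by case: eqP => [<-|_]; rewrite ?yat; ring.
    * apply: (scan_skip sc) => g; rewrite /coord_inv.
      have -> : (th + 1 <= s aAL i%:Z) = (th <= s aAL i%:Z) by lia.
      by have -> : (th + 1 <= s aBE i%:Z) = (th <= s aBE i%:Z) by lia.
- apply: wp_pif_eq; rewrite /= ?sI sN sth => be.
  + apply: wp_consequence (raise_spine_spec A0 sI sA) _.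
    move=> s1 fr [ws f1 cur1 [q1 [B]]] /= [pB fB fmin upds] fro.
    have [AL BE PG] : [/\ s1 aAL i%:Z = s aAL i%:Z, s1 aBE i%:Z = s aBE i%:Z &
        s1 aPG i%:Z = s aPG i%:Z] by rewrite !fr.
    have start g : coord_inv s (tnth z i) (th + 1) i%:Z g -> s aQ i%:Z = 0 /\ g = 0.
      by rewrite /coord_inv; do 2![rewrite ifF; last by lia].
    have y0 : tnth (word A n s) i = DBot.
      by have [_ _ [g gi _]] := sc; have := gi i; rewrite ltnn yi => /start[-> _].
    have ybot : setc (word A n s) i DBot = word A n s by rewrite -y0 setc_id.
    apply: (scan_advance sc (v := DTop)) => //.
    * move=> b j bb ji; move: bb; rewrite !inE.
      by move=> /orP[|/orP[|/orP[|/orP[|/orP[|/orP[]]]]]] /eqP->;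
        first [exact: fr | exact: fro].
    * by rewrite y0.
    * move=> g /start[_ ->]; rewrite /coord_inv AL BE PG ifT; last by lia.
      split=> //; rewrite add0r y0.
      (* Jumping from bottom to top, the comparison with [z] involves the increment of [f] towards
         the coordinate of [z] itself. *)
      have -> : diamond_join (diamond_meet (tnth z i) DTop) DBot = tnth z i.
        by case: (tnth z i).
      set e := (f _ - _) in fmin upds.
      set w := (f (word A n s1) - _) in upds *.
      set ez := (f (setc _ _ (tnth z i)) - _).
      rewrite cur in e w fmin upds *.
      have fs1 := fU (word A n s1); have fs := fU (word A n s).
      have fBU := fU (setc (word A n s) i (decode A B)).
      have := @settles_spine A N U (s aPG i%:Z) (s aAL i%:Z) (s aBE i%:Z) B e w ez
                (tnth z i) pP pB be0 ba aN.
      rewrite -be => /(_ ltac:(lia) ltac:(lia) ltac:(lia) ltac:(lia)).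
      have ez0 : tnth z i = DBot -> ez = 0 by rewrite /ez => ->; rewrite ybot subrr.
      have ez1 : tnth z i = DTop -> ez = w by rewrite /ez /w ws => ->.
      (* For an atom other than that of [B], [two_atoms] gives [w <= e + ez]. *)
      have eza b : tnth z i = DAtom b -> e <= ez /\ (decode A B <> tnth z i -> w - e <= ez).
        rewrite /ez => ->; split=> // Bb; have [c Bc] := page_decode pB.
        have cb : c != b by apply: contra_not_neq Bb => <-.
        have := two_atoms sf y0 cb; rewrite -ws -Bc /w /e; lia.
      by move=> /(_ ez0 ez1 eza); case: ifP upds => _ [-> -> ->].
  + apply: (scan_skip sc) => g; rewrite /coord_inv.
    have -> : (4 * U < s aAL i%:Z - s aBE i%:Z) = false by lia.
    by have -> : (th + 1 <= s aBE i%:Z) = (th <= s aBE i%:Z) by lia.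
Qed.

Lemma clip_cell_spec a (s : store) (i : 'I_n) : a != aI -> s aI 0 = i%:Z -> s aNN 0 = N ->
  wp (value_oracle f) true (clip_cell a) (fun s1 =>
    s1 a i%:Z = clip N (s a i%:Z) /\ forall j, j <> i%:Z -> s1 a j = s a j) s.
Proof.
move=> aI' sI sN; rewrite /clip_cell /clip; split; rewrite /= sI => c1.
  apply: wp_set => s1 E1; rewrite ifT; last by lia.
  rewrite E1 /= sI !eqxx; split=> // j ji; rewrite E1 /= sI eqxx /=.
  by case: eqP ji.
rewrite ifF; last by lia.
split; rewrite /= sI sN => c2.
  apply: wp_set => s1 E1; rewrite ifT; last by lia.
  rewrite E1 /= sI !eqxx; split=> // j ji; rewrite E1 /= sI eqxx /=.
  by case: eqP ji.
by rewrite /wp ifF; last by lia.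
Qed.

Lemma update_spec (s : store) (i : 'I_n) : s aI 0 = i%:Z -> s aNN 0 = N ->
  wp (value_oracle f) true update (fun s1 =>
    (s1 aPG i%:Z, s1 aAL i%:Z, s1 aBE i%:Z) =
      move N (s aPG i%:Z) (s aAL i%:Z) (s aBE i%:Z) (s aPB i%:Z) (s aXA i%:Z) (s aXB i%:Z) /\
    forall a j, a \in [:: aPG; aAL; aBE] -> j <> i%:Z -> s1 a j = s a j) s.
Proof.
move=> sI sN; rewrite /update /move; apply: wp_seq.
set r := (let: (_, _, _) := _ in _).
suff: wp (value_oracle f) true
  (pif_eq (aPB @i) (aPG @i)
    (aAL @i<- esub (aAL @i) (aXA @i) ;; aBE @i<- esub (aBE @i) (aXB @i))
    (aE <- esub (aBE @i) (aXA @i) ;; aW <- esub (aAL @i) (aXB @i) ;;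
     PIf (esub (cell aW) (cell aE))
       (aAL @i<- cell aW ;; aBE @i<- cell aE)
       (aPG @i<- aPB @i ;; aAL @i<- cell aE ;; aBE @i<- cell aW)))%P
  (fun s1 => (s1 aPG i%:Z, clip N (s1 aAL i%:Z), clip N (s1 aBE i%:Z)) = r /\
    forall a j, a \in [:: aPG; aAL; aBE] -> j <> i%:Z -> s1 a j = s a j) s.
  move=> W; apply: wp_consequence W _ => s1 fr [e1 fr1].
  have I1 : s1 aI 0 = i%:Z by rewrite fr.
  have N1 : s1 aNN 0 = N by rewrite fr.
  apply: wp_seq; apply: wp_consequence (@clip_cell_spec aAL _ _ isT I1 N1) _ => s2 fr2 [e2 f2].
  have I2 : s2 aI 0 = i%:Z by rewrite fr2.
  have N2 : s2 aNN 0 = N by rewrite fr2.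
  apply: wp_consequence (@clip_cell_spec aBE _ _ isT I2 N2) _ => s3 fr3 [e3 f3].
  split; first by rewrite -e1 e3 !fr3 // e2 !fr2.
  move=> a j aa ji; rewrite -(fr1 a j) //; move: aa; rewrite !inE => /or3P[]/eqP->.
  - by rewrite fr3 // fr2.
  - by rewrite fr3 // f2.
  - by rewrite f3 // fr2.
apply: wp_pif_eq; rewrite /= sI => c.
  apply: wp_seq; apply: wp_set => s1; rewrite /= sI => E1.
  apply: wp_set => s2; rewrite /= !E1 /= sI => E2.
  split; first by rewrite !E2 !E1 /= !eqxx /r c eqxx.
  move=> a j aa /eqP/negPf ji; rewrite E2 E1 ji !andbF //.
apply: wp_seq; apply: wp_set => s1; rewrite /= sI => E1.
apply: wp_seq; apply: wp_set => s2; rewrite /= !E1 /= sI => E2.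
rewrite /r; move/eqP/negPf: c => ->.
split; rewrite /= !E2 !E1 /= => c.
  rewrite ifT; last by lia.
  apply: wp_seq; apply: wp_set => s3; rewrite /= !E2 !E1 /= sI => E3.
  apply: wp_set => s4; rewrite /= !E3 !E2 !E1 /= sI => E4.
  split; first by rewrite !E4 !E3 !E2 !E1 /= !eqxx.
  move=> a j aa /eqP/negPf ji; rewrite E4 E3 E2 E1 ji !andbF.
  by move: aa; rewrite !inE => /or3P[]/eqP->.
rewrite ifF; last by lia.
apply: wp_seq; apply: wp_set => s3; rewrite /= !E2 !E1 /= sI => E3.
apply: wp_seq; apply: wp_set => s4; rewrite /= !E3 !E2 !E1 /= sI => E4.
apply: wp_set => s5; rewrite /= !E4 !E3 !E2 !E1 /= sI => E5.
split; first by rewrite !E5 !E4 !E3 !E2 !E1 /= !eqxx.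
move=> a j aa /eqP/negPf ji; rewrite E5 E4 E3 E2 E1 ji !andbF.
by move: aa; rewrite !inE => /or3P[]/eqP->.
Qed.

End Round.
#[local] Arguments wp : simpl never.

(** * Decrease of the squared distance *)

Section Descent.
Variables (A : finType) (n : nat) (f : diamond_prod A n -> int).
Hypothesis sf : submodular f.
Hypothesis A0 : (0 < #|A|)%N.
Variables (z : diamond_prod A n) (N U : int).
Hypothesis fU : forall y, f y <= U.
Hypothesis fz : f z <= -1.
Hypothesis NE : N = 24 * (n%:Z * (U * U)).

Lemma N_ge0 : 0 <= N.
Proof. by rewrite NE; nia. Qed.

Definition params_ok (s : store) : Prop :=
  [/\ s aN 0 = n%:Z, s aNN 0 = N, s aK 0 = 4 * U, s aKA 0 = #|A|%:Z & s aN1 0 = N + 1].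

Lemma params_ok_eq (s s1 : store) :
  (forall a, a \in [:: aN; aNN; aK; aKA; aN1] -> s1 a 0 = s a 0) ->
  params_ok s -> params_ok s1.
Proof. by move=> E [p1 p2 p3 p4 p5]; split; rewrite E. Qed.

Lemma scanned_eq (s s1 : store) th m :
  (forall a j, a \in [:: aAL; aBE; aPG; aQ; aPB; aXA; aXB; aCUR] -> s1 a j = s a j) ->
  scanned f z N U s th m -> scanned f z N U s1 th m.
Proof.
move=> E [cur f0 [g gi gs]].
have W : word A n s1 = word A n s by apply: word_eq => j; apply: E.
rewrite /scanned W E //; split=> //; exists g => // j.
apply: coord_inv_eq (gi j) => a aa; apply: E.
by move: aa; rewrite !inE; case: (a == aCUR); rewrite ?orbT // orbF.
Qed.

Lemma state_ok_eq (s s1 : store) :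
  (forall a j, a \in [:: aAL; aBE; aPG] -> s1 a j = s a j) ->
  state_ok A n N s -> state_ok A n N s1.
Proof. by move=> E ok j; have := ok j; rewrite !E. Qed.

Lemma reset_spec (s : store) : params_ok s ->
  wp (value_oracle f) true (PFor aI aN (PSet aQ (cell aI) (ECst 0)))
    (fun s1 => forall j : 'I_n, s1 aQ j%:Z = 0) s.
Proof.
case=> sn _ _ _ _; apply: (wp_for (m := n)
  (Inv := fun m s1 => forall j : 'I_n, (j < m)%N -> s1 aQ j%:Z = 0)).
- by rewrite sn.
- by [].
- move=> i s1 ni sI fr inv; apply: wp_set => s2; rewrite /= sI => E2 j ji.
  rewrite upd_other // E2 /= eqz_nat; case: eqP => // jni; apply: inv; lia.
- by move=> s1 _ inv j; apply: inv; exact: ltn_ord.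
Qed.

Lemma scan_spec (s : store) : params_ok s -> state_ok A n N s ->
  (forall j : 'I_n, s aQ j%:Z = 0) -> s aCUR 0 = f (word A n s) ->
  0 <= f (word A n s) ->
  wp (value_oracle f) true (PFor aTH aN1 (PFor aI aN event))
    (fun s1 => scanned f z N U s1 0 n) s.
Proof.
move=> par ok q0 cur f0; have [sn sN sK sA sN1] := par; have N0 := N_ge0.
have w0 : word A n s = bottom A n.
  by apply: eq_from_tnth => j; rewrite !tnth_mktuple q0.
(* At threshold [N + 1] the inequality would require the value at the bottom to be at most 0. The
   start is therefore stated at threshold [N] with no coordinate scanned, where both terms
   cancel. *)
apply: (wp_for (m := (absz N).+1) (Inv := fun h s1 =>
  if h == 0%N then scanned f z N U s1 N 0 else scanned f z N U s1 (N - h%:Z + 1) n)).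
- have -> : s aN1 0 = (absz N).+1%:Z by lia.
  by [].
- apply: (@scanned_eq s); first move=> a j.
    by rewrite !inE => aa; rewrite upd_other //; apply: contraL aa => /eqP->.
  split=> //; exists (fun=> 0).
    move=> j; have [_ _ ba aN] := ok j; rewrite /coord_inv ltn0.
    by do 2![rewrite ifF; last by lia]; rewrite q0.
  by rewrite w0 meet_bottom big1 ?subrr.
- move=> h s1 hN sTH fr inv.
  have {}inv : scanned f z N U s1 (N - h%:Z) 0.
    case: (h =P 0%N) inv => [->|_]; first by rewrite subr0.
    case=> c1 f1 [g gi gs]; split=> //; exists g.
      by move=> j; have := gi j; rewrite ltn_ord ltn0.
    (* Lowering the threshold decreases the left-hand side because the current value of [f] is
       nonnegative. *)
    by apply: le_trans gs; rewrite lerD2r ler_wpM2r //; lia.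
  apply: (wp_for (m := n) (Inv := fun i s2 => scanned f z N U s2 (N - h%:Z) i)).
  + by rewrite fr // sn.
  + apply: scanned_eq inv => a j; rewrite !inE => aa.
    by rewrite upd_other //; apply: contraL aa => /eqP->.
  + move=> i s2 ni sI fr2 inv2.
    have fr3 a j : a \notin aTH :: aI :: writes event -> s2 a j = s a j.
      by rewrite inE negb_or => /andP[a1 a2]; rewrite fr2 // fr // inE negb_or a1.
    apply: (wp_consequence (Q := fun s3 => scanned f z N U s3 (N - h%:Z) i.+1)).
      have sTH2 : s2 aTH 0 = h%:Z by rewrite fr2.
      apply: (@event_spec _ _ _ sf z N U fU _ _ (Ordinal ni) A0 sI) => //.
      * by rewrite fr3.
      * by rewrite fr3.
      * by rewrite fr3.
      * by rewrite sTH2.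
      * by apply: state_ok_eq ok => a j; rewrite !inE => /or3P[]/eqP->; rewrite fr3.
    move=> s3 _; apply: scanned_eq => a j; rewrite !inE => aa.
    by rewrite upd_other //; apply: contraL aa => /eqP->.
  + move=> s2 _ inv2.
    rewrite /=; have -> : N - h.+1%:Z + 1 = N - h%:Z by lia.
    apply: scanned_eq inv2 => a j; rewrite !inE => aa.
    by rewrite upd_other //; apply: contraL aa => /eqP->.
- move=> s1 _ /=; have -> : N - (absz N).+1%:Z + 1 = 0 by lia.
  by [].
Qed.

Definition potential (s : store) : int :=
  \sum_(j < n) sqdist N (s aPG j%:Z) (s aAL j%:Z) (s aBE j%:Z) (tnth z j).

(** The gains sum to at least [- N * f z >= N]. The first-order decrease is thus at least [4 * N],
    of which the [n] error terms cost exactly [N]. *)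
Lemma updates_spec (s : store) : params_ok s -> state_ok A n N s ->
  scanned f z N U s 0 n ->
  wp (value_oracle f) true (PFor aI aN update)
    (fun s1 => state_ok A n N s1 /\ potential s1 <= potential s - 3 * N) s.
Proof.
move=> par ok [cur f0 [g gi gs]]; have [sn sN sK sA sN1] := par; have N0 := N_ge0.
(* At threshold 0 every [be] has been passed, so each coordinate is finished and the tape spells the
   top element. *)
have fin (j : 'I_n) : s aQ j%:Z = 1 /\ settles N U (s aPG j%:Z) (s aAL j%:Z) (s aBE j%:Z)
    (s aPB j%:Z) (s aXA j%:Z) (s aXB j%:Z) (tnth z j) (g j).
  have [_ b0 _ _] := ok j.
  by have := gi j; rewrite ltn_ord /coord_inv b0.
have wz : Order.meet z (word A n s) = z.
  by apply: meet_top => j; rewrite tnth_mktuple (fin j).1.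
have gN : N <= \sum_j g j.
  apply: le_trans gs; rewrite wz mul0r sub0r -mulrN -[X in X <= _]mulr1.
  by rewrite ler_wpM2l //; lia.
apply: (wp_for (m := n) (Inv := fun m s1 => forall j : 'I_n, if (j < m)%N then
    [/\ page A (s1 aPG j%:Z), 0 <= s1 aBE j%:Z, s1 aBE j%:Z <= s1 aAL j%:Z,
        s1 aAL j%:Z <= N &
      sqdist N (s1 aPG j%:Z) (s1 aAL j%:Z) (s1 aBE j%:Z) (tnth z j) <=
      sqdist N (s aPG j%:Z) (s aAL j%:Z) (s aBE j%:Z) (tnth z j) - 4 * g j + 24 * (U * U)]
    else [/\ s1 aPG j%:Z = s aPG j%:Z, s1 aAL j%:Z = s aAL j%:Z & s1 aBE j%:Z = s aBE j%:Z])).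
- by rewrite sn.
- by move=> j; rewrite ltn0 !upd_other.
- move=> i s1 ni sI fr inv.
  have N1 : s1 aNN 0 = N by rewrite fr.
  apply: wp_consequence (@update_spec _ _ f N s1 (Ordinal ni) sI N1) _ => s2 _ [E fr2] j.
  rewrite !upd_other // ltnS; case: (j =P Ordinal ni) => [-> /=|/eqP jni].
    have := inv (Ordinal ni); rewrite /= ltnn leqnn => -[P1 A1 B1].
    have [_] := fin (Ordinal ni); rewrite /settles /=.
    by move: E; rewrite /= P1 A1 B1 !fr //= => <-.
  have ji : j%:Z <> i%:Z.
    by case=> ji; case/negP: jni; apply/eqP/val_inj.
  rewrite !fr2 //; have := inv j.
  have -> // : (j <= i)%N = (j < i)%N.
  by rewrite leq_eqVlt; case: eqP => // ji'; case: ji; rewrite ji'.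
- move=> s1 _ inv; split=> [j|]; first by have := inv j; rewrite ltn_ord => -[].
  have h : potential s1 <= \sum_(j < n) (sqdist N (s aPG j%:Z) (s aAL j%:Z)
      (s aBE j%:Z) (tnth z j) - 4 * g j + 24 * (U * U)).
    by apply: ler_sum => j _; have := inv j; rewrite ltn_ord => -[].
  apply: le_trans h _; rewrite big_split sumrB -/(potential s) -mulr_sumr /=.
  rewrite sumr_const card_ord -mulr_natl.
  by move: (potential s) (\sum_j g j) gN => p G; rewrite NE; lia.
Qed.

Lemma round_spec (s : store) : params_ok s -> state_ok A n N s ->
  wp (value_oracle f) true round
    (fun s1 => state_ok A n N s1 /\ potential s1 <= potential s - 3 * N) s.
Proof.
move=> par ok; apply: wp_seq.
apply: wp_consequence (reset_spec par) _ => s1 fr1 q1.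
apply: wp_seq; apply: wp_query; rewrite answerE => f0 s2 E2.
apply: wp_seq; apply: wp_set => s3; rewrite /= !E2 /= => E3.
have W3 : word A n s3 = word A n s1 by apply: word_eq => j; rewrite E3 E2.
have fr3 a j : a \notin [:: aI; aQ; aR; aCUR] -> s3 a j = s a j.
  rewrite !inE !negb_or => /and4P[/negPf aI' /negPf aQ' /negPf aR' /negPf aC'].
  by rewrite E3 E2 aC' aR' /= fr1 // !inE aI' aQ'.
have par3 : params_ok s3.
  by apply: params_ok_eq par => a; rewrite !inE => aa; apply: fr3;
     rewrite !inE; apply: contraL aa;
     do !case/orP; move/eqP->.
have ok3 : state_ok A n N s3.
  by apply: state_ok_eq ok => a j; rewrite !inE => /or3P[]/eqP->; rewrite fr3.
apply: wp_seq; apply: wp_consequence (scan_spec par3 ok3 _ _ _) _.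
- by move=> j; rewrite E3 E2 q1.
- by rewrite W3 E3 eqxx.
- by rewrite W3.
move=> s4 fr4 sc.
have par4 : params_ok s4.
  by apply: params_ok_eq par3 => a; rewrite !inE => aa; apply: fr4; move: aa;
     do !case/orP; move/eqP->.
have ok4 : state_ok A n N s4.
  by apply: state_ok_eq ok3 => a j; rewrite !inE => /or3P[]/eqP->; rewrite fr4.
apply: wp_consequence (updates_spec par4 ok4 sc) _ => s5 _ [ok5 p5]; split=> //.
apply: le_trans p5 _; rewrite lerD2r le_eqVlt; apply/orP; left; apply/eqP.
by apply: eq_bigr => j _; rewrite !fr4 // !fr3.
Qed.

(** Without a negative answer, [T] rounds would push a sum of squares below zero; hence the
    postcondition [False] in strict mode. *)
Lemma main_loop_spec (s : store) (T : nat) : params_ok s -> state_ok A n N s ->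
  s aT 0 = T%:Z -> potential s < 3 * N * T%:Z ->
  wp (value_oracle f) true main_loop (fun=> False) s.
Proof.
move=> par ok sT pT.
apply: (wp_for (m := T) (Inv := fun m s1 =>
   state_ok A n N s1 /\ potential s1 <= potential s - 3 * N * m%:Z)).
- by rewrite sT.
- rewrite mulr0 subr0; split; last by [].
  by apply: state_ok_eq ok => a j; rewrite !inE => /or3P[]/eqP->; rewrite upd_other.
- move=> m s1 mT _ fr [ok1 p1].
  have par1 : params_ok s1.
    by apply: params_ok_eq par => a; rewrite !inE => aa; apply: fr; move: aa;
      do !case/orP; move/eqP->.
  apply: wp_consequence (round_spec par1 ok1) _ => s2 _ [ok2 p2]; split.
    by apply: state_ok_eq ok2 => a j; rewrite !inE => /or3P[]/eqP->; rewrite upd_other.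
  apply: le_trans p2 _; apply: le_trans (_ : potential s - 3 * N * m%:Z - 3 * N <= _).
    by rewrite lerD2r.
  by move: (potential s) => p; lia.
- move=> s1 _ [ok1 p1].
  have : 0 <= potential s1.
    apply: sumr_ge0 => j _; rewrite /sqdist.
    by case: (tnth z j) => [|a|]; try case: ifP => _; rewrite addr_ge0 // -expr2 sqr_ge0.
  by move: (potential s1) (potential s) p1 pT => p1 p; lia.
Qed.

End Descent.
#[local] Arguments decode : simpl never.

(** * The scale found from single coordinates *)

Section Survey.
Variables (A : finType) (n : nat) (f : diamond_prod A n -> int).
Let k := #|A|.

(** The running time must be bounded on all runs, including those with negative answers, so this
    bound is proved in the non-strict mode. *)
Lemma survey_cost_spec (s : store) (F : nat) : (forall y, (absz (f y) <= F)%N) ->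
  s aN 0 = n%:Z -> s aKB 0 = k.+2%:Z -> (absz (s aR 0%R) <= F)%N ->
  wp (value_oracle f) false survey
    (fun s1 => (absz (s1 aU 0%R) <= 1 + F + n * (k.+2 * F))%N) s.
Proof.
move=> fF sn sK sR; apply: wp_seq; apply: wp_set => s1 /= E1.
apply: (wp_for (m := n) (Inv := fun i s2 => (absz (s2 aU 0%R) <= 1 + F + i * (k.+2 * F))%N)).
- by rewrite E1 sn.
- by rewrite upd_other // E1 /=; lia.
- move=> i s2 ni sI fr inv; apply: wp_seq.
  apply: (wp_for (m := k.+2) (Inv := fun j s3 =>
     (absz (s3 aU 0%R) <= 1 + F + i * (k.+2 * F) + j * F)%N)).
  + by rewrite fr // E1 /= sK.
  + by rewrite upd_other // mul0n addn0.
  + move=> j s3 jk sJ fr3 inv3; apply: wp_seq; apply: wp_set => s4 E4.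
    apply: wp_seq; apply: wp_query_any => s5 R5 fr5; apply: wp_set => s6 /= E6.
    rewrite upd_other // E6 /= R5 fr5 // E4 /= answerE.
    by have := fF (word A n s4); lia.
  + move=> s3 fr3 inv3; apply: wp_seq; apply: wp_set => s4 E4.
    apply: wp_set => s5 E5; rewrite upd_other // E5 E4 /=; lia.
- by [].
Qed.

Lemma decode_onto (v : diamond A) : exists2 c : nat, (c < k.+2)%N & decode A c%:Z = v.
Proof.
case: v => [|a|]; [by exists 0%N| |by exists 1%N].
by have [j jk E] := decode_atom a; exists j.+2.
Qed.

Hypothesis sf : submodular f.

Lemma survey_spec (s : store) :
  s aN 0 = n%:Z -> s aKB 0 = k.+2%:Z -> (forall j : 'I_n, s aQ j%:Z = 0) ->
  s aR 0 = f (bottom A n) -> 0 <= f (bottom A n) ->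
  wp (value_oracle f) true survey (fun s1 => [/\ forall y, f y <= s1 aU 0,
    1 <= s1 aU 0 & forall j : 'I_n, s1 aPG j%:Z = 2]) s.
Proof.
move=> sn sK sQ sR f0; apply: wp_seq; apply: wp_set => s1; rewrite /= sR => E1.
(* [aU] dominates the partial sum over the first [i] coordinates whatever entries [y] has there. *)
apply: (wp_for (m := n) (Inv := fun (i : nat) (s2 : store) =>
  [/\ forall y : diamond_prod A n, 1 + f (bottom A n) + \sum_(m < n | (m < i)%N)
         f (setc (bottom A n) m (tnth y m)) <= s2 aU 0,
      forall (m : 'I_n) (v : diamond A), (m < i)%N -> 0 <= f (setc (bottom A n) m v),
      forall j : 'I_n, s2 aQ j%:Z = 0 &
      forall j : 'I_n, (j < i)%N -> s2 aPG j%:Z = 2])).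
- by rewrite E1 sn.
- split=> // [y|j]; first by rewrite upd_other // E1 /= big_pred0 ?addr0.
  by rewrite upd_other // E1 /= sQ.
- move=> i s2 ni sI fr [inv1 inv2 q2 pg2]; apply: wp_seq; pose o := Ordinal ni.
  apply: (wp_for (m := k.+2) (Inv := fun j s3 =>
    [/\ s2 aU 0 <= s3 aU 0,
       forall c, (c < j)%N -> 0 <= f (setc (bottom A n) o (decode A c%:Z)) /\
         s2 aU 0 + f (setc (bottom A n) o (decode A c%:Z)) <= s3 aU 0 &
       forall m : 'I_n, m != o -> s3 aQ m%:Z = 0])).
  + by rewrite fr // E1 /= sK.
  + by split=> // m _; rewrite upd_other.
  + move=> j s3 jk sJ fr3 [u3 c3 q3].
    have I3 : s3 aI 0 = i%:Z by rewrite fr3.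
    apply: wp_seq; apply: wp_set => s4; rewrite /= I3 sJ => E4.
    have W4 : word A n s4 = setc (bottom A n) o (decode A j%:Z).
      have -> : word A n s4 = setc (word A n s3) o (decode A j%:Z).
        by apply: word_set => m; rewrite E4.
      apply: eq_from_tnth => m; rewrite !tnth_setc !tnth_mktuple.
      by case: eqP => // /eqP mo; rewrite q3.
    apply: wp_seq; apply: wp_query; rewrite answerE W4 => f4 s5 E5.
    apply: wp_set => s6; rewrite /= !E5 !E4 /= => E6.
    split.
    * by rewrite upd_other // E6 /=; lia.
    * move=> c; rewrite upd_other // E6 /= ltnS leq_eqVlt => /orP[/eqP->|/c3[h1 h2]].
        by split=> //; lia.
      by split=> //; lia.
    * move=> m mo; rewrite upd_other // E6 E5 E4 /= eqz_nat.
      have -> : (m == i :> nat) = false by apply: contraNF mo => /eqP mi; apply/eqP/val_inj.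
      by rewrite q3.
  + move=> s3 fr3 [u3 c3 q3].
    have I3 : s3 aI 0 = i%:Z by rewrite fr3.
    apply: wp_seq; apply: wp_set => s4; rewrite /= I3 => E4.
    apply: wp_set => s5; rewrite /= E4 /= I3 => E5.
    have U5 : upd s5 aI 0 i.+1%:Z aU 0 = s3 aU 0 by rewrite upd_other // E5 E4.
    split.
    * move=> y; rewrite U5; have [c ck cE] := decode_onto (tnth y o).
      have [h1 h2] := c3 c ck; rewrite cE in h1 h2.
      apply: le_trans h2; rewrite (bigD1 o) //= addrCA addrC lerD2r.
      apply: le_trans (inv1 y); rewrite lerD2l le_eqVlt; apply/orP; left.
      by apply/eqP; apply: eq_bigl => m; rewrite -val_eqE /=; lia.
    * move=> m v; rewrite ltnS leq_eqVlt => /orP[/eqP mi|]; last exact: inv2.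
      have -> : m = o by exact: val_inj.
      by have [c ck <-] := decode_onto v; case: (c3 c ck).
    * move=> j; rewrite upd_other // E5 E4 /= eqz_nat.
      case: eqP => // /eqP jo; apply: q3; exact: jo.
    * move=> j; rewrite upd_other // E5 E4 /= eqz_nat ltnS.
      case: eqP => // /eqP jo; rewrite leq_eqVlt (negPf jo) /= => ji.
      by rewrite fr3 // pg2.
- move=> s2 _ [inv1 inv2 q2 pg2]; split.
  + move=> y; apply: le_trans (upper_bound sf y f0 _) _.
      by move=> i v; apply: inv2; exact: ltn_ord.
    apply: le_trans (inv1 y); rewrite -addrA ler_wpDl // lerD2l.
    rewrite le_eqVlt; apply/orP; left; apply/eqP.
    by apply: eq_bigl => i; rewrite ltn_ord.
  + apply: le_trans (inv1 (bottom A n)); rewrite -addrA lerDl addr_ge0 //.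
    by apply: sumr_ge0 => i _; apply: inv2; exact: ltn_ord.
  + by move=> j; apply: pg2; exact: ltn_ord.
Qed.

End Survey.

(** * Membership of the zero vector *)

Lemma zero_in_PM (R : realType) (A : finType) (n : nat) (f : diamond_prod A n -> int) :
  PM (fun y => (f y)%:~R : R) 0 <-> forall y, 0 <= f y.
Proof.
have v0 y : vec_val (0 : {ffun 'I_n * A -> R}) y = 0.
  rewrite /vec_val big1 // => i _; case: (tnth y i) => [|a|] //; first by rewrite ffunE.
  (* All pair sums are 0, and so is the default [head 0 r], hence the maximum is 0. *)
  rewrite /pair_max /seqmax; set r := [seq _ | _ <- _].
  have r0 : all (pred1 0) r by apply/allP => v /mapP[p _ ->]; rewrite /= !ffunE addr0.
  have -> : head 0 r = 0 by case: (r) r0 => //= v r1 /andP[/eqP->].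
  elim: r r0 => [|v r IH] /=; first by rewrite big_nil.
  by case/andP=> /eqP-> /IH; rewrite big_cons => ->; rewrite maxxx.
by split=> h y; have := h y; rewrite v0 ler0z.
Qed.

(** * Polynomial running time *)

(** The outer variable stands for [F], the inner one for [n]. *)
Definition is_polynomial (g : nat -> nat -> nat) : Prop :=
  exists p : {poly {poly nat}}, forall F n, p.[F%:P].[n] = g F n.

Lemma is_polynomial_const c : is_polynomial (fun _ _ => c).
Proof. by exists c%:P%:P => F n; rewrite !hornerC. Qed.

Lemma is_polynomial_fst : is_polynomial (fun F _ => F).
Proof. by exists 'X => F n; rewrite hornerX hornerC. Qed.

Lemma is_polynomial_snd : is_polynomial (fun _ n => n).
Proof. by exists 'X%:P => F n; rewrite hornerC hornerX. Qed.

Lemma is_polynomial_add g h : is_polynomial g -> is_polynomial h ->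
  is_polynomial (fun F n => g F n + h F n)%N.
Proof. by move=> [p pE] [q qE]; exists (p + q) => F n; rewrite !hornerD pE qE. Qed.

Lemma is_polynomial_mul g h : is_polynomial g -> is_polynomial h ->
  is_polynomial (fun F n => g F n * h F n)%N.
Proof. by move=> [p pE] [q qE]; exists (p * q) => F n; rewrite !hornerM pE qE. Qed.

Lemma is_polynomial_succ g : is_polynomial g -> is_polynomial (fun F n => (g F n).+1).
Proof.
move=> [p pE]; exists (p + 1) => F n.
by rewrite hornerD hornerD pE -[1]/(1%:P) hornerC hornerC -[X in _ = X]addn1.
Qed.

(** * An explicit bound on the cost *)

Section Bound.
Variable k : nat.

(** The summand [k] accounts for the literals [k] and [k + 2] in [setup], whose weight grows with
    their value. *)
Definition kappa : nat := (k + 30)%N.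

Definition loop_env (n Nb Tb : nat) (a : nat) : nat :=
  match a with
  | aN => n
  | aT => Tb
  | aKA => k
  | aKB => k.+2
  | aN1 => Nb.+1
  | _ => 0%N
  end.

Definition bound_U (F n : nat) : nat := (1 + F + n * (k.+2 * F))%N.
Definition bound_N (F n : nat) : nat := (24 * (n * (bound_U F n * bound_U F n)))%N.
Definition bound_T (F n : nat) : nat := (n * bound_N F n)%N.

Definition stage_cost (n b M : nat) : nat := (M * step_cost n kappa (b + kappa * M))%N.

(** Bit lengths of the memory between the stages. The [5] counts the steps of [setup]: two
    assignments and a query of three steps. [bits3] adds the new constants by value, since they are
    computed with products. *)
Definition bits1 (F n : nat) : nat := (n + F + kappa * 5)%N.
Definition steps2 (F n : nat) : nat := steps survey (loop_env n 0 0).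
Definition bits2 (F n : nat) : nat := (bits1 F n + kappa * steps2 F n)%N.
Definition bits3 (F n : nat) : nat :=
  (bits2 F n + (bound_N F n + (4 * bound_U F n + (bound_T F n + 1))))%N.
Definition steps4 (F n : nat) : nat :=
  steps main_loop (loop_env n (bound_N F n) (bound_T F n)).
Definition bits4 (F n : nat) : nat := (bits3 F n + kappa * steps4 F n)%N.
Definition constants_cost (F n : nat) : nat :=
  (100 * (1 + bound_U F n + n + bound_N F n + bound_T F n
          + n * (bound_U F n * bound_U F n) + bound_U F n * bound_U F n))%N.

Definition total_cost (F n : nat) : nat :=
  (stage_cost n (n + F) 5 + (stage_cost n (bits1 F n) (steps2 F n) +
   (constants_cost F n + (stage_cost n (bits3 F n) (steps4 F n) +
     stage_cost n (bits4 F n) 1))))%N.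

Ltac prove_polynomial :=
  do !first [assumption | apply: is_polynomial_fst | apply: is_polynomial_snd
    | apply: is_polynomial_const | apply: is_polynomial_add
    | apply: is_polynomial_mul | apply: is_polynomial_succ].

Lemma total_cost_polynomial : is_polynomial total_cost.
Proof.
have pU : is_polynomial bound_U by rewrite /bound_U; prove_polynomial.
have pN : is_polynomial bound_N by rewrite /bound_N; prove_polynomial.
have pT : is_polynomial bound_T by rewrite /bound_T; prove_polynomial.
have p2 : is_polynomial steps2 by rewrite /steps2 /=; prove_polynomial.
have p4 : is_polynomial steps4 by rewrite /steps4 /=; prove_polynomial.
by rewrite /total_cost /stage_cost /step_cost /constants_cost /bits4 /bits3 /bits2 /bits1;
  prove_polynomial.
Qed.

Definition decision_program : cmd :=
  CSeq (compile (setup k)) (CSeq (compile survey)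
    (CSeq (compile constants) (CSeq (compile main_loop) (compile verdict)))).

End Bound.

(** * Cost and correctness of the whole run *)

Section Run.
Variables (A : finType) (n : nat) (f : diamond_prod A n -> int).
Let k := #|A|.
Let F := max_abs f.
Let orc := value_oracle f.

Definition after_setup := den orc (setup k) (init_store n).
Definition after_survey := den orc survey after_setup.
Definition after_constants := den orc constants after_survey.
Definition after_main := den orc main_loop after_constants.
Definition after_verdict := den orc verdict after_main.

Lemma absz_le_max y : (absz (f y) <= F)%N.
Proof. exact: leq_bigmax. Qed.

Lemma word_init (s : store) : (forall j, s aQ j = 0) -> word A n s = bottom A n.
Proof. by move=> h; apply: eq_from_tnth => j; rewrite !tnth_mktuple h. Qed.

Lemma after_setupE a j : after_setup a j =
  if (a == aFL) && (j == 0) then (if f (bottom A n) < 0 then 1 else 0)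
  else if (a == aR) && (j == 0) then f (bottom A n)
  else if (a == aKB) && (j == 0) then k.+2%:Z
  else if (a == aKA) && (j == 0) then k%:Z
  else init_store n a j.
Proof.
rewrite /after_setup /=; set s := upd _ aKB _ _.
have -> : answer orc s = f (bottom A n) by rewrite answerE word_init.
case: ifP => _; rewrite /upd.
  by case: (a =P aFL) => [->|].
by case: (a =P aFL) => [->|//] /=; case: eqP => // ->.
Qed.

Lemma bound_after_survey : (absz (after_survey aU 0%R) <= bound_U k F n)%N.
Proof.
apply: (wp_sound (st := false) (p := survey)
  (Q := fun s1 => (absz (s1 aU 0%R) <= bound_U k F n)%N)) => //.
apply: survey_cost_spec; rewrite ?after_setupE //=; exact: absz_le_max.
Qed.

Lemma after_constantsE : let s := after_survey in
  let N := 24 * (n%:Z * (s aU 0 * s aU 0)) in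
  forall a j, after_constants a j =
    if (a == aN1) && (j == 0) then N + 1
    else if (a == aT) && (j == 0) then n%:Z * N
    else if (a == aK) && (j == 0) then 4 * s aU 0
    else if (a == aNN) && (j == 0) then N
    else s a j.
Proof.
move=> s N a j; rewrite /after_constants /=.
have sn : after_survey aN 0 = n%:Z by rewrite /after_survey den_frame // after_setupE.
by rewrite /upd /= sn.
Qed.

(** This straight-line stage runs once, so bounding each bit length by the absolute value
    suffices. *)
Lemma constants_exec : exists2 t,
  exec orc (compile constants) after_survey t after_constants &
  (t <= constants_cost k F n)%N.
Proof.
have sn : after_survey aN 0 = n%:Z by rewrite /after_survey den_frame // after_setupE.
have uU := bound_after_survey.
rewrite /after_constants /=; eexists.
  by apply: ExSeq; [exact: ExSet|apply: ExSeq; [exact: ExSet|apply: ExSeq; exact: ExSet]].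
rewrite /= /upd /= sn; set u := after_survey aU 0 in uU *.
rewrite /constants_cost /bound_T /bound_N; set B := bound_U k F n in uU *.
set m := (24 * (n%:Z * (u * u))).
have b0 : bits 0%R = 0%N by [].
have uu : (absz (u * u)%R <= B * B)%N by rewrite abszM leq_mul.
have nuu : (absz (n%:Z * (u * u))%R <= n * (B * B))%N by rewrite abszM leq_mul.
have mm : (absz m <= 24 * (n * (B * B)))%N by rewrite abszM leq_mul.
have nm : (absz (n%:Z * m)%R <= n * (24 * (n * (B * B))))%N by rewrite abszM leq_mul.
have h1 := bits_le_absz m; have h2 := bits_le_absz (n%:Z * (u * u)).
have h3 := bits_le_absz (u * u); have h4 := bits_le_absz u.
have h5 := bits_le_absz n%:Z; have h6 := bits_le_absz (n%:Z * m).
have h7 := bits_le_absz (4 * u); have h8 := bits_le_absz (m + 1).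
have h9 : (bits 24%R <= 24)%N by exact: bits_le_absz.
have h10 : (bits 4%R <= 4)%N by exact: bits_le_absz.
have h11 : (bits 1%R <= 1)%N by exact: bits_le_absz.
have u4 : (absz (4 * u)%R <= 4 * B)%N by rewrite abszM leq_mul.
have m1 : (absz (m + 1)%R <= absz m + 1)%N by lia.
rewrite !b0 absz_nat in h5 *.
move: (bits m) (bits (n%:Z * (u * u))) (bits (u * u)) (bits u) (bits n%:Z) (bits (n%:Z * m))
  (bits (4 * u)) (bits (m + 1)) (bits 24) (bits 4) (bits 1) h1 h2 h3 h4 h5 h6 h7 h8 h9 h10 h11.
move: (absz m) (absz (n%:Z * (u * u))%R) (absz (u * u)%R) (absz (n%:Z * m)%R) (absz (4 * u)%R)
  (absz (m + 1)%R) uu nuu mm nm u4 m1 => *.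
lia.
Qed.

Lemma decision_program_exec : exists2 t,
  exec orc (decision_program k) (init_store n) t after_verdict &
  (t <= total_cost k F n)%N.
Proof.
have orcF w : (absz (orc w) <= F)%N by exact: absz_le_max.
have k6 : (6 <= kappa k)%N by rewrite /kappa; lia.
have uU := bound_after_survey.
have sn : after_survey aN 0 = n%:Z by rewrite /after_survey den_frame // after_setupE.
have m0 : magnitude (init_store n) (n + F).
  move=> a i; rewrite /init_store /upd; case: ifP => _; last by rewrite expn_gt0.
  by apply: leq_trans (ltn_expl n (isT : 1 < 2)%N) _; rewrite leq_exp2l ?leq_addr.
have [m1 [t1 e1 c1]] := @runs_compile n orc F (kappa k) orcF (setup k) (init_store n)
  (loop_env k n 0 0) k6 isT ltac:(rewrite /light_prog /= /light /= /kappa; lia)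
  ltac:(by []) ltac:(by []) (n + F)%N (leq_addl n F) m0.
have [|||m2 [t2 e2 c2]] := @runs_compile n orc F (kappa k) orcF survey after_setup
  (loop_env k n 0 0) k6 isT ltac:(rewrite /light_prog /= /light /= /kappa; lia)
  _ _ (bits1 k F n) _ m1.
- by move=> b; rewrite !inE => /orP[]/eqP->.
- by move=> b; rewrite !inE => /orP[]/eqP->; rewrite after_setupE.
- by rewrite /bits1; lia.
have [t3 e3 c3] := constants_exec.
have N3 : (absz (24 * (n%:Z * (after_survey aU 0 * after_survey aU 0)))%R <= bound_N k F n)%N.
  by rewrite /bound_N !abszM !leq_mul.
have m3 : magnitude after_constants (bits3 k F n).
  have small v : (v <= bound_N k F n + (4 * bound_U k F n + (bound_T k F n + 1)))%N ->
      (v < 2 ^ bits3 k F n)%N.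
    move=> vb; apply: leq_trans (ltn_expl v (isT : 1 < 2)%N) _; rewrite leq_exp2l //.
    by rewrite /bits3; apply: leq_trans vb (leq_addl _ _).
  have T3 : (absz (n%:Z * (24 * (n%:Z * (after_survey aU 0 * after_survey aU 0))))%R
             <= bound_T k F n)%N by rewrite abszM leq_mul.
  have K3 : (absz (4 * after_survey aU 0)%R <= 4 * bound_U k F n)%N by rewrite abszM leq_mul.
  move=> a j; rewrite after_constantsE.
  case: ifP => _; first by apply: small; lia.
  case: ifP => _; first by apply: small; lia.
  case: ifP => _; first by apply: small; lia.
  case: ifP => _; first by apply: small; lia.
  by apply: leq_trans (m2 a j) _; rewrite leq_exp2l // /bits3 leq_addr.
have [|||m4 [t4 e4 c4]] := @runs_compile n orc F (kappa k) orcF main_loop after_constants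
  (loop_env k n (bound_N k F n) (bound_T k F n)) k6 isT
  ltac:(rewrite /light_prog /= /light /= /kappa; lia) _ _ (bits3 k F n) _ m3.
- by move=> b; rewrite !inE => /orP[|/orP[|/orP[|/orP[|/orP[]]]]] /eqP->.
- have NN0 : 0 <= 24 * (n%:Z * (after_survey aU 0 * after_survey aU 0)) by nia.
  have nz (v : int) c : (absz v <= c)%N -> (nat_of_int v <= c)%N by case: v.
  move=> b; rewrite !inE => /orP[|/orP[|/orP[|/orP[|/orP[]]]]] /eqP->;
    apply: nz; rewrite after_constantsE //=.
  + by rewrite abszM leq_mul.
  + by rewrite sn.
  + change (absz (24 * (n%:Z * (after_survey aU 0 * after_survey aU 0)) + 1)%R
            <= (bound_N k F n).+1)%N; lia.
  + by rewrite sn.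
  + by rewrite /after_survey den_frame // after_setupE.
  + by rewrite sn.
- by rewrite /bits3 /bits2 /bits1; lia.
have [|m5 [t5 e5 c5]] := @runs_set n orc F (kappa k) aN (ECst 0)
  (esub (ECst 1) (cell aFL)) after_main ltac:(rewrite /light /= /kappa; lia)
  ltac:(rewrite /light /= /kappa; lia) (bits4 k F n) _ m4.
  by rewrite /bits4 /bits3 /bits2 /bits1; lia.
exists (t1 + (t2 + (t3 + (t4 + t5))))%N.
  by do 4![apply: ExSeq => //; first eassumption].
by rewrite /total_cost /stage_cost; do 4![apply: leq_add => //].
Qed.

(** The flag is 0 or 1, so [1 - aFL] is nonzero exactly when it is 0. *)
Lemma after_verdict_accepting : accepting after_verdict = (after_main aFL 0 == 0).
Proof.
rewrite /accepting /after_verdict /= /upd /=.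
have wf1 : wf main_loop by [].
have wf2 : wf survey by [].
suff [->|->] : after_main aFL 0 = 0 \/ after_main aFL 0 = 1 by [].
rewrite /after_main; have [->|] := flag_cases orc after_constants wf1; last by right.
rewrite after_constantsE /= /after_survey.
have [->|] := flag_cases orc after_setup wf2; last by right.
by rewrite after_setupE /=; case: ifP => _; [right|left].
Qed.

Lemma after_verdict_correct : (1 <= n)%N -> (0 < #|A|)%N -> submodular f ->
  accepting after_verdict <-> forall y, 0 <= f y.
Proof.
move=> n1 A0 sf; rewrite after_verdict_accepting; split=> [/eqP fl|f0]; last first.
  have orc0 w : 0 <= orc w by exact: f0.
  rewrite /after_main flag_nonneg // after_constantsE /= /after_survey flag_nonneg //.
  by rewrite after_setupE /= ltNge f0.
have fl2 : after_constants aFL 0 = 0 by exact: flag_mono fl.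
have fl1 : after_survey aFL 0 = 0 by move: fl2; rewrite after_constantsE.
have fl0 : after_setup aFL 0 = 0 by exact: flag_mono fl1.
have fb : 0 <= f (bottom A n).
  by move: fl0; rewrite after_setupE /=; case: ltP.
have [fU U1 pg] : [/\ forall y, f y <= after_survey aU 0,
    1 <= after_survey aU 0 & forall j : 'I_n, after_survey aPG j%:Z = 2].
  apply: (wp_sound (st := true) (p := survey) (Q := fun s1 => [/\ forall y, f y <= s1 aU 0,
    1 <= s1 aU 0 & forall j : 'I_n, s1 aPG j%:Z = 2])) => //.
  by apply: survey_spec => // *; rewrite after_setupE.
move=> z; rewrite leNgt; apply/negP => fz.
have {}fz : f z <= -1 by lia.
have sn : after_survey aN 0 = n%:Z by rewrite /after_survey den_frame // after_setupE.
have sK : after_survey aKA 0 = k%:Z by rewrite /after_survey den_frame // after_setupE.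
have ab a j : a \in [:: aAL; aBE] -> after_constants a j = 0.
  by rewrite !inE after_constantsE => /orP[]/eqP-> /=;
     rewrite /after_survey den_frame // after_setupE.
pose u := after_survey aU 0; pose N := 24 * (n%:Z * (u * u)).
have N1 : 1 <= N.
  by rewrite mulr_ege1 // mulr_ege1 // ?mulr_ege1 // lez_nat.
have NN : 1 <= N * N by rewrite mulr_ege1.
have nN : 0 <= n%:Z * N by rewrite mulr_ge0 //; lia.
have pgc (j : 'I_n) : after_constants aPG j%:Z = 2 by rewrite after_constantsE pg.
(* A run that ends with flag 0 satisfies every strict postcondition, here [False]. *)
suff W : wp orc true main_loop (fun=> False) after_constants.
  exact: (wp_sound (isT : wf main_loop) W (fun=> fl)).
apply: (@main_loop_spec A n f sf A0 z N u fU fz erefl _ (absz (n%:Z * N))).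
- by split; rewrite after_constantsE.
- move=> j; rewrite (ab aAL) // (ab aBE) // pgc; split=> //; last by lia.
  exact: (page_nat A0).
- by rewrite after_constantsE /= -/u -/N gez0_abs.
- rewrite gez0_abs //.
  (* The starting point is the bottom, at squared distance at most [2 * (N * N)] from [z] in each
     coordinate; the total is below [3 * N] times the number [n * N] of rounds. *)
  apply: (@le_lt_trans _ _ (\sum_(j < n) (2 * (N * N)))); last first.
    by rewrite sumr_const card_ord -mulr_natl natz; nia.
  apply: ler_sum => j _; rewrite (ab aAL) // (ab aBE) // /sqdist.
  by case: (tnth z j) => [|a|]; try case: ifP => _; lia.
Qed.

End Run.

Theorem theorem7 (R : realType) (A : finType) (hA : (3 <= #|A|)%N) :
  exists (prog : cmd) (p : {poly {poly nat}}),
    forall (n : nat) (f : diamond_prod A n -> int),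
      (1 <= n)%N -> submodular f ->
      exists (t : nat) (s : store),
        [/\ exec (value_oracle f) prog (init_store n) t s,
            (t <= p.[(max_abs f)%:P].[n])%N
          & accepting s <-> PM (fun y => (f y)%:~R : R) 0].
Proof.
have [p pE] := total_cost_polynomial #|A|.
exists (decision_program #|A|), p => n f n1 sf.
have [t e c] := decision_program_exec f.
exists t, (after_verdict f); split=> //; first by rewrite pE.
have A0 : (0 < #|A|)%N by exact: leq_trans hA.
by rewrite zero_in_PM; exact: after_verdict_correct.
Qed.
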